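(* Let $f:\mathbb{R}^d\to\mathbb{R}^d$ be of class $\mathcal{C}^2$ and assume that there exists $q\in\mathbb{N}$ such that \[ \sup_{x\in\mathbb{R}^d}\frac{\|f(x)\|+\sum_{j=1}^{2}\sup_{\|h_1\|,\ldots,\|h_j\|\le 1}\|D^jf(x).(h_1,\ldots,h_j)\|}{1+\|x\|^q}<\infty, \] and that there exists $\gamma>0$ such that for all $x_1,x_2\in\mathbb{R}^d$ \[ \langle f(x_2)-f(x_1),x_2-x_1\rangle\le-\gamma\|x_2-x_1\|^2 . \] Let $(X_n)_{n\ge 0}$ be defined by the explicit tamed Euler–Maruyama scheme with time-step size $\Delta t$ and initial value $X_0=x_0$, \[ X_{n+1}=X_n+\frac{\Delta t}{1+\alpha\Delta t\|f(X_n)\|}f(X_n)+\sum_{k=1}^K\sigma_k\,\Delta\beta_n^k,\qquad n\ge 0 . \] Then for every $m\in[1,\infty)$ there exists a polynomial function $\mathcal{P}_m:\mathbb{R}^2\to\mathbb{R}$ such that for all $T\in(0,\infty)$ and $x_0\in\mathbb{R}^d$, \[ \sup_{\Delta t\in(0,\Delta t_0]}\ \sup_{0\le n\Delta t\le T}\ \mathbb{E}[\|X_n\|^m]\le \mathcal{P}_m(T,\|x_0\|). \]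
   Context: $d\in\mathbb{N}$; $\langle\cdot,\cdot\rangle$ and $\|\cdot\|$ are the standard inner product and norm on $\mathbb{R}^d$. $D^jf(x).(h_1,\ldots,h_j)$ denotes the $j$-th derivative of $f$ at $x$ in directions $h_1,\ldots,h_j\in\mathbb{R}^d$. $\sigma_1,\ldots,\sigma_K\in\mathbb{R}^d$ are fixed vectors, and $\beta^1,\ldots,\beta^K$ are independent standard real-valued Wiener processes on a probability space satisfying the usual conditions. $\Delta t_0>0$ is arbitrarily fixed, $\Delta t\in(0,\Delta t_0]$ is the time-step size, $t_n=n\Delta t$, and $\Delta\beta_n^k=\beta^k(t_{n+1})-\beta^k(t_n)$. $\alpha\in(0,\infty)$ is a fixed parameter and $x_0\in\mathbb{R}^d$ is deterministic. The process $(X_n)_{n\ge0}$ depends on $\Delta t$ and $x_0$ (omitted in the notation). The polynomial $\mathcal{P}_m$ may depend on $m$ and on the fixed data $f,\sigma_1,\ldots,\sigma_K,\alpha,\Delta t_0,d$, but not on $\Delta t$, $n$, $T$, $x_0$. *)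

(* Defs.v *)
From HB Require Import structures.
From mathcomp Require Import all_boot all_order all_algebra.
From mathcomp Require Import all_classical all_reals all_analysis.

Set Implicit Arguments.
Unset Strict Implicit.
Unset Printing Implicit Defensive.

Import Order.TTheory GRing.Theory Num.Theory.
Import numFieldNormedType.Exports.

Local Open Scope classical_set_scope.
Local Open Scope ring_scope.

Definition dotp (R : realType) (d : nat) (x y : 'rV[R]_d) : R :=
  \sum_(i < d) x 0 i * y 0 i.

(* The library norm [`|x|] of a row vector is the sup norm. *)
Definition enorm (R : realType) (d : nat) (x : 'rV[R]_d) : R :=
  Num.sqrt (dotp x x).

(* [nderive f [:: h_1; ...; h_j] x] is D^j f(x).(h_1, ..., h_j), obtained by
   iterating the Frechet differential ['d]; it is meaningful for functions of
   class C^j.  The sup norm and the Euclidean norm define the same ['d]. *)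
Fixpoint nderive (R : realType) (d : nat) (f : 'rV[R]_d -> 'rV[R]_d)
    (hs : seq 'rV[R]_d) : 'rV[R]_d -> 'rV[R]_d :=
  match hs with
  | [::] => f
  | h :: hs' => fun x => 'd (nderive f hs') x h
  end.

(* In finite dimension, x |-> Df(x) is of class C^k as a map into the linear
   maps iff x |-> Df(x).h is of class C^k for every vector h. *)
Fixpoint classC (R : realType) (d : nat) (k : nat)
    (f : 'rV[R]_d -> 'rV[R]_d) : Prop :=
  match k with
  | 0 => continuous f
  | k'.+1 => (forall x, differentiable f x) /\
             (forall h, classC k' (fun x => 'd f x h))
  end.

(* The supremum of ||D^j f(x).(h_1, ..., h_j)|| over Euclidean unit balls. *)
Definition nderive_norm (R : realType) (d : nat) (f : 'rV[R]_d -> 'rV[R]_d)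
    (j : nat) (x : 'rV[R]_d) : \bar R :=
  ereal_sup [set (enorm (nderive f hs x))%:E |
             hs in [set hs : j.-tuple 'rV[R]_d |
                    forall i, enorm (tnth hs i) <= 1]].

Definition poly_growth (R : realType) (d : nat) (f : 'rV[R]_d -> 'rV[R]_d)
    (k q : nat) : Prop :=
  (ereal_sup (range (fun x : 'rV[R]_d =>
     ((enorm (f x))%:E + \sum_(1 <= j < k.+1) nderive_norm f j x) *
     ((1 + enorm x ^+ q)^-1)%:E)) < +oo)%E.

Definition one_sided_lipschitz (R : realType) (d : nat)
    (f : 'rV[R]_d -> 'rV[R]_d) (gamma : R) : Prop :=
  forall x1 x2 : 'rV[R]_d,
    dotp (f x2 - f x1) (x2 - x1) <= - gamma * enorm (x2 - x1) ^+ 2.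

(* [F t] is only constrained for t >= 0. *)
Definition usual_conditions (disp : measure_display)
    (Omega : measurableType disp) (R : realType) (P : probability Omega R)
    (F : R -> set (set Omega)) : Prop :=
  [/\ forall t, 0 <= t -> sigma_algebra setT (F t) /\ F t `<=` measurable,
      forall s t, 0 <= s -> s <= t -> F s `<=` F t,
      measure_is_complete P,
      P.-negligible `<=` F 0 &
      forall t, 0 <= t -> F t = \bigcap_(s in [set s | t < s]) F s].

(* Mutual independence of finitely many classes of events.  All classes used
   below contain [setT], so the product formulas for subfamilies follow. *)
Definition independent_classes (disp : measure_display)
    (Omega : measurableType disp) (R : realType) (P : probability Omega R)
    (n : nat) (G : 'I_n -> set (set Omega)) : Prop :=
  forall A : 'I_n -> set Omega, (forall i, G i (A i)) ->
    P (\bigcap_(i in [set: 'I_n]) A i) = (\prod_(i < n) P (A i))%E.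

Definition rv_events (disp : measure_display) (Omega : measurableType disp)
    (R : realType) (X : Omega -> R) : set (set Omega) :=
  [set X @^-1` B | B in @measurable _ R].

Definition process_events (disp : measure_display)
    (Omega : measurableType disp) (R : realType)
    (W : R -> Omega -> R) : set (set Omega) :=
  <<s \bigcup_(t in [set t | 0 <= t]) rv_events (W t) >>.

(* [normal_prob m s] is parametrised by the standard deviation [s]. *)
Definition wiener_process (disp : measure_display)
    (Omega : measurableType disp) (R : realType) (P : probability Omega R)
    (W : R -> {RV P >-> R}) : Prop :=
  [/\ {ae P, forall w, W 0 w = 0},
      {ae P, forall w, {within `[0, +oo[, continuous (fun t => W t w)}},
      forall s t : R, 0 <= s -> s < t -> forall B : set R, measurable B ->
        P ((fun w => W t w - W s w) @^-1` B) =
        normal_prob 0 (Num.sqrt (t - s)) B &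
      forall (n : nat) (t : nat -> R), 0 <= t 0%N ->
        {homo t : i j / (i <= j)%N >-> i <= j} ->
        independent_classes P
          (fun i : 'I_n => rv_events (fun w => W (t i.+1) w - W (t i) w))].
Arguments wiener_process {disp Omega R} P W.

Definition independent_processes (disp : measure_display)
    (Omega : measurableType disp) (R : realType) (P : probability Omega R)
    (K : nat) (W : 'I_K -> R -> {RV P >-> R}) : Prop :=
  independent_classes P
    (fun k => process_events (fun t => W k t : Omega -> R)).
Arguments independent_processes {disp Omega R} P {K} W.

Fixpoint tamed_euler (R : realType) (d K : nat) (Omega : Type)
    (f : 'rV[R]_d -> 'rV[R]_d) (sigma : 'I_K -> 'rV[R]_d) (alpha : R)
    (W : 'I_K -> R -> Omega -> R) (dt : R) (x0 : 'rV[R]_d)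
    (n : nat) (w : Omega) : 'rV[R]_d :=
  match n with
  | 0 => x0
  | n'.+1 =>
      let x := tamed_euler f sigma alpha W dt x0 n' w in
      x + (dt / (1 + alpha * dt * enorm (f x))) *: f x
        + \sum_(k < K) (W k (n'.+1%:R * dt) w - W k (n'%:R * dt) w) *: sigma k
  end.

(* Main.v *)
(* Write V(x) = (1 + |x|^2)^P.  The tamed drift x -> x + g(x) contracts V only in
   the region dt (1 + |x|^2)^r <= 1, where |f|^2 <= C (1 + |x|^2)^r makes the
   taming harmless; elsewhere one step moves x by at most 1/alpha, so that after
   j steps the q-th moment is at most (1 + C j + |x|)^q, and there
   j <= T / dt <= T (1 + |x|^2)^r turns this crude bound into a V(x) with
   a = (2 + C T)^q.  Hence the minimum of the crude bound and of a V(x) + C' a j dt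
   does not increase in mean along the scheme, j being the number of remaining
   steps.  Adding the Gaussian increments one at a time, each is independent of
   the sigma-algebra of the previous ones, so that the mean is an iterated
   integral; no conditional expectation is needed. *)

Require Import Defs.
From HB Require Import structures.
From mathcomp Require Import all_boot all_order all_algebra.
From mathcomp Require Import all_classical all_reals all_analysis.
From mathcomp Require Import measurable_realfun ring lra.

Set Implicit Arguments.
Unset Strict Implicit.
Unset Printing Implicit Defensive.

Import Order.TTheory GRing.Theory Num.Theory.
Import numFieldNormedType.Exports.

Local Open Scope classical_set_scope.
Local Open Scope ring_scope.

(** * Integration against an independent variable *)

(** The bound has to be polynomial in [T], so no Gronwall factor exp(C T) may appear: the
    contraction rate c of the drift must outweigh the multiplicative growth of V under the noise.
    This is possible because a centred increment raises the mean of V only by a multiple of dt times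
    a lower power of 1 + |x|^2, hence by at most eps dt V + C dt for any eps > 0, and eps is chosen
    after c. The obstacle is the taming. When dt |f(x)| is large, the effective step is about 1 /
    (alpha |f(x)|); the dissipation shrinks with it while the displacement stays of order one, and
    the one-sided condition no longer guarantees a decrease of V. The usual remedy stops the scheme
    at its exit from a ball depending on dt and estimates the probability of the exit. The minimum
    of two bounds replaces this: the integral of a minimum is at most the minimum of the integrals,
    so both bounds pass through a noise increment separately, and only the drift step has to switch
    from one to the other. *)

Lemma integral_independent_pair d1 d2 d3 (T : measurableType d1)
    (S : measurableType d2) (U : measurableType d3) (R : realType)
    (P : probability T R) (nu : probability U R) (X : {mfun T >-> S})
    (Z : {mfun T >-> U})
    (XZ : forall A B, measurable A -> measurable B ->
      P (X @^-1` A `&` Z @^-1` B) = (P (X @^-1` A) * nu B)%E)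
    (h : (S * U)%type -> \bar R) (mh : measurable_fun setT h)
    (h0 : forall x, (0 <= h x)%E) :
  (\int[P]_w h (X w, Z w) = \int[P]_w \int[nu]_z h (X w, z))%E.
Proof.
pose XZp w := (X w, Z w).
have mXZ : measurable_fun setT XZp by exact: measurable_fun_pair.
pose XZm : {mfun T >-> (S * U)%type} := mfun_Sub (mem_set mXZ).
have -> : (\int[P]_w h (X w, Z w) = \int[distribution P XZm]_x h x)%E.
  by rewrite ge0_integral_distribution.
(* The joint law and the product measure agree on rectangles, which determine the product
   measure. *)
have XZE A : measurable A -> (distribution P X \x nu)%E A = distribution P XZm A.
  by apply: product_measure_unique => B C mB mC; exact: XZ.
rewrite (eq_measure_integral (distribution P X \x nu)%E); last first.
  by move=> A mA _; apply/esym; exact: XZE.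
rewrite fubini_tonelli1 //= ge0_integral_distribution //.
- exact: measurable_fun_fubini_tonelli_F.
- by move=> y; exact: integral_ge0.
Qed.

(** In the variable [A], both sides are finite measures that agree on a pi-system containing the
    whole space, hence on the sigma-algebra it generates. *)
Lemma independent_sigma_algebra d (T : measurableType d) (R : realType)
    (P : probability T R) (G : set (set T)) (C : set T) (x : \bar R) :
  measurable C -> G `<=` measurable -> G setT -> setI_closed G ->
  (forall A, G A -> P (A `&` C) = (P A * x)%E) -> P C = x ->
  forall A, <<s G >> A -> P (A `&` C) = (P A * x)%E.
Proof.
move=> mC Gm GT GI GC PC A sGA; rewrite -PC.
have r0 : 0 <= fine (P C) by rewrite fine_ge0.
have -> : (P A * P C = mscale (NngNum r0) P A)%E.
  by rewrite /mscale /= fineK ?fin_num_measure // muleC.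
apply: (@g_sigma_algebra_measure_unique _ R T G Gm (fun=> setT) _ _
  (mrestr P mC) (mscale (NngNum r0) P) GI) sGA => //.
- by apply/seteqP; split => // w _; exists 0%N.
- move=> B GB; apply: etrans (GC B GB) _.
  by rewrite -[RHS]/((fine (P C))%:E * P B)%E fineK ?fin_num_measure // muleC PC.
- by move=> k; rewrite (le_lt_trans (probability_le1 _ _)) ?ltry //;
  exact: measurableI.
Qed.

(** * The sigma-algebra of the past increments *)

Section history.
Context d (T : measurableType d) (R : realType) (P : probability T R).
Context (E : finType) (D : E -> {mfun T >-> R}).

(** Cylinders that constrain only the coordinates in [J]: a pi-system generating the sigma-algebra
    of the variables [D i] with [J i]. *)
Definition history (J : pred E) : set (set T) :=
  [set \bigcap_(i in [set: E]) D i @^-1` B i | B in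
    [set B : E -> set R | (forall i, measurable (B i)) /\
                          (forall i, ~~ J i -> B i = setT)]].

Lemma historyT J : history J setT.
Proof.
exists (fun=> setT) => //.
by apply/seteqP; split.
Qed.

Lemma historyI J : setI_closed (history J).
Proof.
move=> _ _ [B [mB JB] <-] [C [mC JC] <-].
exists (fun i => B i `&` C i).
  by split=> i; [exact: measurableI | move=> Ji; rewrite JB ?JC ?setTI].
apply/seteqP; split=> [w BC|w [wB wC] i iT].
  by split=> i /BC [].
by split; [exact: wB | exact: wC].
Qed.

Lemma history_measurable J : history J `<=` measurable.
Proof.
move=> _ [B [mB _] <-]; apply: fin_bigcap_measurable.
  exact: finite_finset.
by move=> i _; rewrite -[X in measurable X]setTI; exact: measurable_funP.
Qed.

Lemma history_coordinate (J : pred E) i (B : set R) :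
  J i -> measurable B -> history J (D i @^-1` B).
Proof.
move=> Ji mB; exists (fun j => if j == i then B else setT).
  split=> j; first by case: ifP.
  by case: eqP => // ->; rewrite Ji.
apply/seteqP; split=> [w /(_ i I) /=|w wB j _ /=]; first by rewrite eqxx.
by case: eqP => // ->.
Qed.

(** The slot [i] of a cylinder is free and contributes the factor [nu setT], that is 1, to the
    product formula; placing [B] there turns this factor into [nu B]. *)
Lemma history_independent (nu : set R -> \bar R) (J : pred E) i :
  nu setT = 1%E ->
  (forall B : E -> set R, (forall i, measurable (B i)) ->
    P (\bigcap_(i in [set: E]) D i @^-1` B i) = (\prod_i nu (B i))%E) ->
  ~~ J i -> forall A B, <<s history J >> A -> measurable B ->
  P (A `&` D i @^-1` B) = (P A * nu B)%E.
Proof.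
move=> nuT DE Ji A B sA mB.
have mDB : measurable (D i @^-1` B).
  by rewrite -[X in measurable X]setTI; exact: measurable_funP.
have HB A' : history J A' -> P (A' `&` D i @^-1` B) = (P A' * nu B)%E.
  move=> [C [mC JC] <-].
  have -> : \bigcap_(j in [set: E]) D j @^-1` C j `&` D i @^-1` B =
      \bigcap_(j in [set: E]) D j @^-1` (if j == i then B else C j).
    apply/seteqP; split=> [w [wC wB] j _ /=|w wBC].
      by case: eqP => [->//|_]; exact: wC.
    split; last by have := wBC i I; rewrite /= eqxx.
    move=> j _ /=; have := wBC j I; rewrite /=.
    by case: eqP => [->|//]; rewrite JC.
  rewrite !DE //; last by move=> j; case: ifP.
  rewrite (bigD1 i) //= eqxx [in RHS](bigD1 i) //= JC //.
  rewrite nuT mul1e muleC; congr (_ * _)%E.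
  by apply: eq_bigr => j /negbTE ->.
apply: independent_sigma_algebra sA => //.
- exact: history_measurable.
- exact: historyT.
- exact: historyI.
- by have := HB _ (historyT J); rewrite setTI probability_setT mul1e.
Qed.

End history.

(** * Gaussian integrals *)

Section normal_integrals.
Context {R : realType}.
Local Notation mu := (@lebesgue_measure R).
Implicit Types (phi : R -> R) (dt : R).

(** The Radon-Nikodym derivative and the Gaussian density have the same integral over every
    measurable set, so they agree almost everywhere. *)
Lemma ge0_integral_normal_prob (m s : R) (phi : R -> \bar R) :
  (forall z, 0 <= phi z)%E -> measurable_fun setT phi ->
  (\int[normal_prob m s]_z phi z =
   \int[mu]_z (phi z * (normal_pdf m s z)%:E))%E.
Proof.
move=> phi0 mphi.
pose g := Radon_Nikodym_SigmaFinite.f (normal_prob m s) mu.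
have dom : normal_prob m s `<< mu := normal_prob_dominates m s.
have gi : mu.-integrable setT g by exact: Radon_Nikodym_SigmaFinite.f_integrable.
have mpdf : measurable_fun setT (fun z => (normal_pdf m s z)%:E).
  by apply/measurable_EFinP; exact: measurable_normal_pdf.
rewrite -(Radon_Nikodym_SigmaFinite.change_of_variables dom) //.
apply: ae_eq_integral => //.
- by apply: emeasurable_funM => //; exact: measurable_int gi.
- exact: emeasurable_funM.
- apply: ae_eqe_mul2l; apply: integral_ae_eq => // E _ mE.
  by rewrite -Radon_Nikodym_SigmaFinite.f_integral.
Qed.

Lemma integral_normal_prob_sym s (phi : R -> \bar R) : s != 0 ->
  (forall z, 0 <= phi z)%E -> measurable_fun setT phi ->
  (\int[normal_prob 0 s]_z phi (- z)%R = \int[normal_prob 0 s]_z phi z)%E.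
Proof.
move=> s0 phi0 mphi.
pose g z := (phi z * (normal_pdf 0 s z)%:E)%E.
have mpdf : measurable_fun setT (fun z => (normal_pdf 0 s z)%:E).
  by apply/measurable_EFinP; exact: measurable_normal_pdf.
have mg : measurable_fun setT g by exact: emeasurable_funM.
have g0 z : (0 <= g z)%E by rewrite mule_ge0 // lee_fin normal_pdf_ge0.
rewrite !ge0_integral_normal_prob //; last exact: measurableT_comp.
transitivity (\int[mu]_z (g \o -%R) z)%E.
  apply: eq_integral => z _; rewrite /g /=; congr (_ * _%:E)%E.
  by rewrite !normal_pdfE // /normal_fun !subr0 sqrrN.
transitivity (\int[pushforward mu (-%R : _ -> measurableTypeR R)]_z g z)%E.
  by rewrite ge0_integral_pushforward.
apply: (@eq_measure_integral _ _ _ _ mu) => A mA _.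
exact: lebesgue_measureN.
Qed.

(** Times the density of variance dt, the majorant exp(z^2 / (4 dt)) becomes sqrt 2 times the
    density of variance 2 dt; the constant is rounded up to 2. *)
Lemma integral_normal_prob_le (dt C : R) phi : 0 < dt -> 0 <= C ->
  measurable_fun setT phi ->
  (forall z, 0 <= phi z <= C * expR (z ^+ 2 / (4 * dt))) ->
  (\int[normal_prob 0 (Num.sqrt dt)]_z (phi z)%:E <= (2 * C)%:E)%E.
Proof.
move=> dt0 C0 mphi phiE.
have mpdf (s : R) : measurable_fun [set: measurableTypeR R]
    (fun z => (normal_pdf 0 s z)%:E).
  by apply/measurable_EFinP; exact: measurable_normal_pdf.
have phi0 z : 0 <= phi z by case/andP: (phiE z).
rewrite ge0_integral_normal_prob //; last exact/measurable_EFinP.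
have s1 : Num.sqrt dt != 0 by rewrite gt_eqF // sqrtr_gt0.
have dt2 : 0 < 2 * dt by rewrite mulr_gt0.
have s2 : Num.sqrt (2 * dt) != 0 by rewrite gt_eqF // sqrtr_gt0.
pose s := Num.sqrt (2 * dt).
have I2 : (\int[mu]_z ((2 * C)%:E * (normal_pdf 0 s z)%:E) = (2 * C)%:E)%E.
  rewrite (ge0_integralZl mu measurableT (mpdf _)).
  - by rewrite integral_normal_pdf mule1.
  - by move=> z _; rewrite lee_fin normal_pdf_ge0.
  - by rewrite lee_fin mulr_ge0.
rewrite -I2; apply: ge0_le_integral.
- exact: measurableT.
- by move=> z _; rewrite -EFinM lee_fin mulr_ge0 // normal_pdf_ge0.
- by apply: emeasurable_funM; [exact/measurable_EFinP | exact: mpdf].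
- by apply: emeasurable_funM; [exact: measurable_cst | exact: mpdf].
move=> z _; rewrite -!EFinM lee_fin !normal_pdfE // /normal_fun !subr0.
have dt_ge0 := ltW dt0; have dt2_ge0 := ltW dt2.
rewrite /normal_peak !sqr_sqrtr //.
set X := dt * pi *+ 2.
have X0 : 0 < X by rewrite /X mulrn_wgt0 // mulr_gt0 // pi_gt0.
have -> : 2 * dt * pi *+ 2 = 2 * X by rewrite /X mulrnAr mulrA.
have E1 : expR (- z ^+ 2 / (2 * dt *+ 2)) =
    expR (z ^+ 2 / (4 * dt)) * expR (- z ^+ 2 / (dt *+ 2)).
  by rewrite -expRD; congr expR; field; rewrite gt_eqF.
rewrite E1.
have X2 : (Num.sqrt X)^-1 <= 2 * (Num.sqrt (2 * X))^-1.
  have sX : 0 < Num.sqrt X by rewrite sqrtr_gt0.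
  have s2X : 0 < Num.sqrt (2 * X) by rewrite sqrtr_gt0 mulr_gt0.
  rewrite ler_pdivlMr // mulrC ler_pdivrMr //.
  have -> : 2 * Num.sqrt X = Num.sqrt (4 * X).
    rewrite sqrtrM // (_ : 4 = 2 ^+ 2 :> R); last by ring.
    by rewrite sqrtr_sqr ger0_norm.
  by rewrite ler_sqrt ?mulr_ge0 // ?ltW //; lra.
have := phiE z => /andP[_ phz].
set e1 := expR _ in phz *; set e2 := expR _.
set a := (Num.sqrt X)^-1 in X2 *; set b := (Num.sqrt _)^-1 in X2 *.
have a0 : 0 <= a by rewrite invr_ge0.
have e20 : 0 <= e2 by exact: expR_ge0.
have -> : 2 * C * (b * (e1 * e2)) = (C * e1) * ((2 * b) * e2) by ring.
apply: ler_pM => //; first exact: mulr_ge0.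
by rewrite ler_wpM2r.
Qed.

(** With u = 8 a k and v = w / (8 k), 1 + a w = 1 + u v <= (1 + u) (1 + v) and 1 + v <= exp(v). The
    rate 1/8 is such that, for w = z^2 / dt, two such factors make up the majorant exp(z^2 / (4 dt))
    of [integral_normal_prob_le]. *)
Lemma poly_le_expR (a w : R) k : 0 <= a -> 0 <= w ->
  (1 + a * w) ^+ k <= (1 + 8 * a * k%:R) ^+ k * expR (w / 8).
Proof.
move=> a0 w0; case: k => [|k].
  by rewrite !expr0 mul1r -[X in X <= _]expR0 ler_expR divr_ge0.
have k0 : (0 : R) < 8 * k.+1%:R by rewrite mulr_gt0.
have -> : w / 8 = w / (8 * k.+1%:R) *+ k.+1.
  by rewrite -[RHS]mulr_natr invfM mulrA mulfVK // pnatr_eq0.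
rewrite -[X in expR X]mulr_natl expRM_natl -exprMn; apply: lerXn2r.
- by rewrite nnegrE addr_ge0 // mulr_ge0.
- by rewrite nnegrE mulr_ge0 ?expR_ge0 // addr_ge0 // !mulr_ge0.
have le1 := expR_ge1Dx (w / (8 * k.+1%:R)).
apply: (@le_trans _ _ ((1 + 8 * a * k.+1%:R) * (1 + w / (8 * k.+1%:R)))).
  have -> : a * w = (8 * a * k.+1%:R) * (w / (8 * k.+1%:R)).
    by field; rewrite addrC natr1 pnatr_eq0.
  set u := 8 * a * _; set v := w / _.
  have u0 : 0 <= u by rewrite !mulr_ge0.
  have v0 : 0 <= v by rewrite divr_ge0 // ltW.
  by nra.
by rewrite ler_wpM2l // addr_ge0 // !mulr_ge0.
Qed.

(** The factor dt comes from z^2 = w dt; one exponential exp(w / 8) absorbs this w and the other the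
    power. The absolute value makes the constant nonnegative before any dt in the range is given. *)
Lemma integral_normal_prob_even_moment (S dt0 : R) k : 0 <= S -> exists2 C, 0 <= C &
  forall dt, 0 < dt <= dt0 ->
  (\int[normal_prob 0 (Num.sqrt dt)]_z
     (z ^+ 2 * (1 + S * z ^+ 2) ^+ k)%:E <= (C * dt)%:E)%E.
Proof.
move=> S0; pose A := (1 + 8 * (S * `|dt0|) * k%:R) ^+ k.
have A0 : 0 <= A by rewrite exprn_ge0 // addr_ge0 // !mulr_ge0 // ?sqr_ge0.
exists (16 * A); first by rewrite mulr_ge0.
move=> dt /andP[dt_gt0 dt_le].
have -> : 16 * A * dt = 2 * (8 * A * dt) by ring.
have dt_ge0 := ltW dt_gt0.
apply: integral_normal_prob_le => //.
- by rewrite !mulr_ge0.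
- apply: measurable_funM; first exact: measurable_funX.
  apply: measurable_funX; apply: measurable_funD => //.
  by apply: measurable_funM => //; exact: measurable_funX.
move=> z; apply/andP; split.
  by rewrite mulr_ge0 ?sqr_ge0 ?exprn_ge0 // addr_ge0 // mulr_ge0 // ?sqr_ge0.
set w := z ^+ 2 / dt.
have w0 : 0 <= w by rewrite divr_ge0 ?sqr_ge0.
have zw : z ^+ 2 = w * dt by rewrite mulfVK // gt_eqF.
have -> : z ^+ 2 / (4 * dt) = w / 8 + w / 8.
  by rewrite /w; field; rewrite gt_eqF.
clearbody w.
rewrite expRD.
have w8 : w <= 8 * expR (w / 8).
  by have := expR_ge1Dx (w / 8); lra.
have := @poly_le_expR (S * `|dt0|) w k.
rewrite -/A mulr_ge0 // => /(_ isT w0) le2.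
have le3 : (1 + S * z ^+ 2) ^+ k <= A * expR (w / 8).
  apply: le_trans le2; apply: lerXn2r.
  - by rewrite nnegrE addr_ge0 // mulr_ge0 // ?sqr_ge0.
  - by rewrite nnegrE addr_ge0 // !mulr_ge0 // ?sqr_ge0.
  rewrite lerD2l zw [w * dt]mulrC mulrA ler_wpM2r // ler_wpM2l //.
  by rewrite (le_trans dt_le) // ler_norm.
rewrite {1}zw.
have -> : 8 * A * dt * (expR (w / 8) * expR (w / 8)) =
  ((8 * expR (w / 8)) * dt) * (A * expR (w / 8)) by ring.
apply: ler_pM => //.
- by rewrite mulr_ge0.
- by rewrite exprn_ge0 // addr_ge0 // mulr_ge0 // ?sqr_ge0.
- by rewrite ler_wpM2r.
Qed.

Lemma integral_normal_prob_abs_moment (S dt0 : R) k : 0 <= S ->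
  exists2 C, 0 <= C & forall dt, 0 < dt <= dt0 ->
  (\int[normal_prob 0 (Num.sqrt dt)]_z
     (S * `|z| * (1 + S * `|z|) ^+ k)%:E <= C%:E)%E.
Proof.
move=> S0.
have [S2 S20 S2E] : exists2 S2, 0 <= S2 & S ^+ 2 = S2.
  by exists (S ^+ 2); rewrite ?sqr_ge0.
pose A := (1 + 8 * (S2 * `|dt0|) * k.+1%:R) ^+ k.+1.
have A0 : 0 <= A by rewrite exprn_ge0 // addr_ge0 // !mulr_ge0 // ?sqr_ge0.
exists (2 * (2 ^+ k.+1 * A)); first by rewrite !mulr_ge0 // exprn_ge0.
move=> dt /andP[dt_gt0 dt_le].
have dt_ge0 := ltW dt_gt0.
apply: integral_normal_prob_le => //.
- by rewrite !mulr_ge0 // exprn_ge0.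
- have mz : measurable_fun setT (fun z : R => S * `|z|).
    by apply: measurable_funM => //; exact: measurableT_comp.
  apply: measurable_funM => //.
  by apply: measurable_funX; exact: measurable_funD.
move=> z; set t := S * `|z|.
have t0 : 0 <= t by rewrite mulr_ge0.
apply/andP; split; first by rewrite mulr_ge0 // exprn_ge0 // addr_ge0.
set w := z ^+ 2 / dt.
have w0 : 0 <= w by rewrite divr_ge0 ?sqr_ge0.
have zw : z ^+ 2 = dt * w by rewrite mulrC mulfVK // gt_eqF.
have -> : z ^+ 2 / (4 * dt) = w / 8 + w / 8.
  by rewrite /w; field; rewrite gt_eqF.
clearbody w.
apply: (@le_trans _ _ ((1 + t) ^+ k.+1)).
  by rewrite exprS ler_wpM2r ?exprn_ge0 ?addr_ge0 // lerDr.
(* From 1 + t <= 2 (1 + t^2), which brings the odd power back to a power in z^2. *)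
apply: (@le_trans _ _ (2 ^+ k.+1 * (1 + S2 * `|dt0| * w) ^+ k.+1)).
  rewrite -exprMn; apply: lerXn2r.
  - by rewrite nnegrE addr_ge0.
  - by rewrite nnegrE mulr_ge0 // addr_ge0 // !mulr_ge0 // ?sqr_ge0.
  have : t ^+ 2 <= S2 * `|dt0| * w.
    rewrite /t exprMn S2E real_normK ?num_real // zw mulrA ler_wpM2r //.
    by rewrite ler_wpM2l // (le_trans dt_le) // ler_norm.
  by have := sqr_ge0 (t - 1); nra.
have := @poly_le_expR (S2 * `|dt0|) w k.+1.
rewrite -/A mulr_ge0 // => /(_ isT w0) le2.
rewrite -(mulrA _ A) ler_wpM2l ?exprn_ge0 // (le_trans le2) // ler_wpM2l //.
by rewrite ler_expR lerDl divr_ge0.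
Qed.

End normal_integrals.

(** * Euclidean norm and elementary inequalities *)

Lemma eq_ler (R : realType) (x y : R) : x = y -> x <= y.
Proof. by move->. Qed.

Section euclidean.
Context {R : realType} {d : nat}.
Implicit Types (x y : 'rV[R]_d) (a : R).

Lemma dotpC x y : dotp x y = dotp y x.
Proof. by apply: eq_bigr => i _; rewrite mulrC. Qed.

Lemma dotpDl x y u : dotp (x + y) u = dotp x u + dotp y u.
Proof.
by rewrite /dotp -big_split; apply: eq_bigr => i _; rewrite mxE mulrDl.
Qed.

Lemma dotpZl a x y : dotp (a *: x) y = a * dotp x y.
Proof. by rewrite /dotp mulr_sumr; apply: eq_bigr => i _; rewrite mxE mulrA. Qed.

Lemma dotpDr x y u : dotp u (x + y) = dotp u x + dotp u y.
Proof. by rewrite dotpC dotpDl !(dotpC u). Qed.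

Lemma dotpZr a x y : dotp x (a *: y) = a * dotp x y.
Proof. by rewrite dotpC dotpZl dotpC. Qed.

Lemma dotp_ge0 x : 0 <= dotp x x.
Proof. by apply: sumr_ge0 => i _; rewrite -expr2 sqr_ge0. Qed.

Lemma dotp_eq0 x : dotp x x = 0 -> x = 0.
Proof.
move=> x0; apply/rowP => i; rewrite mxE; apply/eqP.
rewrite -sqrf_eq0 expr2; apply/eqP; move: i isT.
apply/psumr_eq0P => //; first by move=> i _; rewrite -expr2 sqr_ge0.
Qed.

Lemma dotpD_sqr x y :
  dotp (x + y) (x + y) = dotp x x + 2 * dotp x y + dotp y y.
Proof. by rewrite dotpDl !dotpDr (dotpC y x); ring. Qed.

Lemma dotp_CauchySchwarz x y : dotp x y ^+ 2 <= dotp x x * dotp y y.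
Proof.
have [y0|y0] := eqVneq (dotp y y) 0.
  rewrite (dotp_eq0 y0) -(scale0r (0 : 'rV[R]_d)) !dotpZr.
  by rewrite !mul0r expr2 !mulr0.
have {}y0 : 0 < dotp y y by rewrite lt0r y0 dotp_ge0.
have := dotp_ge0 (dotp y y *: x + (- dotp x y) *: y).
rewrite dotpD_sqr !dotpZl !dotpZr => h.
rewrite -subr_ge0 -(pmulr_rge0 _ y0); apply: le_trans h _.
by apply: eq_ler; ring.
Qed.

Lemma enorm_ge0 x : 0 <= enorm x.
Proof. exact: sqrtr_ge0. Qed.

Lemma enorm_sqr x : enorm x ^+ 2 = dotp x x.
Proof. by rewrite sqr_sqrtr ?dotp_ge0. Qed.

Lemma dotp_le_enorm x y : dotp x y <= enorm x * enorm y.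
Proof.
apply: le_trans (ler_norm _) _; rewrite -(@ler_pXn2r _ 2) ?nnegrE //.
  by rewrite real_normK ?num_real // exprMn !enorm_sqr dotp_CauchySchwarz.
by rewrite mulr_ge0 ?enorm_ge0.
Qed.

Lemma enormD x y : enorm (x + y) <= enorm x + enorm y.
Proof.
rewrite -(@ler_pXn2r _ 2) ?nnegrE ?addr_ge0 ?enorm_ge0 //.
rewrite sqrrD !enorm_sqr dotpD_sqr lerD2r lerD2l -[leRHS]mulr_natl.
by apply: ler_wpM2l => //; exact: dotp_le_enorm.
Qed.

Lemma enormZ a x : enorm (a *: x) = `|a| * enorm x.
Proof.
by rewrite /enorm dotpZl dotpZr mulrA -expr2 sqrtrM ?sqr_ge0 // sqrtr_sqr.
Qed.

End euclidean.

Section powers.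
Context {R : realType}.
Implicit Types (a b s t u z : R) (p : nat).

(** A mean value bound with the derivative taken at the right endpoint. *)
Lemma exprD_le a t p : 0 <= a -> 0 <= t ->
  (a + t) ^+ p.+1 <= a ^+ p.+1 + p.+1%:R * t * (a + t) ^+ p.
Proof.
move=> a0 t0; elim: p => [|p IH]; first by rewrite !expr1 expr0 mulr1 mul1r.
have at0 : 0 <= (a + t) ^+ p.+1 by rewrite exprn_ge0 ?addr_ge0.
rewrite [in leLHS]exprS mulrDl -[p.+2]addn1 natrD.
have le1 : a * (a + t) ^+ p.+1 <=
    a ^+ p.+2 + p.+1%:R * t * (a * (a + t) ^+ p).
  rewrite (exprS a p.+1); apply: le_trans (ler_wpM2l a0 IH) _.
  by apply: eq_ler; ring.
have le2 : a * (a + t) ^+ p <= (a + t) ^+ p.+1.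
  by rewrite exprS ler_wpM2r ?exprn_ge0 ?addr_ge0 // lerDl.
have := ler_wpM2l (mulr_ge0 (ler0n R p.+1) t0) le2.
rewrite addn1 => le3; apply: le_trans (lerD le1 (lexx _)) _.
by rewrite !mulrDl mul1r addrA; apply: lerD => //; rewrite lerD2l.
Qed.

(** A second order Taylor bound. Multiplying by 1 + t creates the terms p t^2 and C t^3, and t^3 <=
    t^2 on the unit interval, whence the recursion C -> 2 C + p. *)
Lemma expr1D_le2 p : exists2 C : R, 0 <= C &
  forall t, `|t| <= 1 -> (1 + t) ^+ p <= 1 + p%:R * t + C * t ^+ 2.
Proof.
elim: p => [|p [C C0 IH]].
  by exists 0 => // t _; rewrite expr0 !mul0r !addr0.
exists (2 * C + p%:R) => [|t t1]; first by rewrite addr_ge0 // mulr_ge0.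
move: (t1); rewrite ler_norml => /andP[t1l t1r].
rewrite exprS; apply: le_trans (ler_wpM2l _ (IH t t1)) _; first by lra.
have : C * t ^+ 2 * t <= C * t ^+ 2.
  by rewrite ler_piMr // mulr_ge0 // sqr_ge0.
by rewrite -natr1; set n := p%:R; nra.
Qed.

(* The factor 1/2 of the symmetrised power removes the first order term. *)
Lemma symmetrized_expr_le p : exists2 C : R, 0 <= C &
  forall a b s z, 1 <= a -> 0 <= s -> b ^+ 2 <= 4 * a * s ->
  ((a + b * z + s * z ^+ 2) ^+ p.+1 + (a - b * z + s * z ^+ 2) ^+ p.+1) / 2 <=
  a ^+ p.+1 + C * s * a ^+ p * (z ^+ 2 * (1 + s * z ^+ 2) ^+ p).
Proof.
have [K K0 KP] := expr1D_le2 p.+1.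
exists (4 * K + p.+1%:R) => [|a b s z a1 s0 bas].
  by rewrite addr_ge0 // mulr_ge0.
have a_gt0 : 0 < a by rewrite (lt_le_trans _ a1).
have [w w0 wE] : exists2 w, 0 <= w & z ^+ 2 = w by exists (z ^+ 2); rewrite ?sqr_ge0.
rewrite wE.
have sw0 : 0 <= s * w by rewrite mulr_ge0.
set A := a + s * w.
have A0 : 0 < A by rewrite /A; lra.
have A_ge0 := ltW A0.
have bz : (b * z) ^+ 2 <= 4 * a * (s * w).
  by rewrite exprMn wE mulrA ler_wpM2r.
have bz1 : (b * z) ^+ 2 <= A ^+ 2.
  by apply: le_trans bz _; rewrite /A; have := sqr_ge0 (a - s * w); nra.
(* Since b^2 <= 4 a s, the inequality of the means gives |b z| <= A, so the two quadratics are A (1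
   + t) and A (1 - t) with |t| <= 1, and the linear terms in t cancel in the sum. *)
set t := b * z / A.
have t1 : `|t| <= 1.
  rewrite /t normrM normfV (gtr0_norm A0) ler_pdivrMr // mul1r.
  by rewrite -(@ler_pXn2r _ 2) ?nnegrE // real_normK ?num_real.
have At2 : A * t ^+ 2 <= 4 * (s * w).
  have -> : A * t ^+ 2 = (b * z) ^+ 2 / A.
    by rewrite /t; field; rewrite gt_eqF.
  rewrite ler_pdivrMr //; apply: le_trans bz _.
  rewrite [leLHS](_ : _ = 4 * (s * w) * a); last by ring.
  by rewrite ler_wpM2l ?mulr_ge0 // /A lerDl.
have -> : a + b * z + s * w = A * (1 + t).
  by rewrite /t /A; field; rewrite gt_eqF.
have -> : a - b * z + s * w = A * (1 + - t).
  by rewrite /t /A; field; rewrite gt_eqF.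
rewrite !exprMn -mulrDr -mulrA.
have E1 : ((1 + t) ^+ p.+1 + (1 + - t) ^+ p.+1) / 2 <= 1 + K * t ^+ 2.
  have := KP t t1; have := KP (- t); rewrite normrN => /(_ t1).
  by rewrite sqrrN mulrN; lra.
have Ap0 : 0 <= A ^+ p by rewrite exprn_ge0.
have Ap1 : 0 <= A ^+ p.+1 by rewrite exprn_ge0.
apply: le_trans (ler_wpM2l Ap1 E1) _.
have le1 : A ^+ p.+1 * (1 + K * t ^+ 2) <=
    A ^+ p.+1 + 4 * K * (s * w) * A ^+ p.
  rewrite mulrDr mulr1 lerD2l exprS.
  have := ler_wpM2l (mulr_ge0 K0 Ap0) At2.
  by congr (_ <= _); ring.
have le2 := exprD_le p (ltW a_gt0) sw0; rewrite -/A in le2.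
have le3 : A ^+ p <= a ^+ p * (1 + s * w) ^+ p.
  rewrite -exprMn; apply: lerXn2r; rewrite ?nnegrE //.
    by rewrite mulr_ge0 ?(ltW a_gt0) // addr_ge0.
  by rewrite mulrDr mulr1 lerD2l ler_peMl.
apply: le_trans le1 _; apply: le_trans (lerD le2 (lexx _)) _.
set C := 4 * K + p.+1%:R.
apply: (@le_trans _ _ (a ^+ p.+1 + C * (s * w) * A ^+ p)).
  by apply: eq_ler; rewrite /C; ring.
have C0 : 0 <= C by rewrite /C addr_ge0 // mulr_ge0.
rewrite lerD2l; apply: le_trans (ler_wpM2l (mulr_ge0 C0 sw0) le3) _.
by apply: eq_ler; ring.
Qed.

(** Either eps a >= 1 and the higher power dominates, or a < 1 / eps. This absorbs lower powers into
    an arbitrarily small multiple of V. *)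
Lemma expr_le_eps a eps p : 0 <= a -> 0 < eps ->
  a ^+ p <= eps * a ^+ p.+1 + eps^-1 ^+ p.
Proof.
move=> a0 e0; have ap0 : 0 <= a ^+ p by rewrite exprn_ge0.
have ep0 : 0 <= eps^-1 by rewrite invr_ge0 ltW.
have [ea|ea] := leP 1 (eps * a).
  apply: ler_wpDr; first by rewrite exprn_ge0.
  by rewrite exprS mulrA ler_peMl.
apply: ler_wpDl; first by rewrite mulr_ge0 ?exprn_ge0 // ltW.
by apply: lerXn2r; rewrite ?nnegrE // -[leRHS]mul1r ler_pdivlMr // mulrC ltW.
Qed.

End powers.

(** * The Gaussian increments *)

Lemma integral_affine_le d (T : measurableType d) (R : realType)
    (P : probability T R) (h phi : T -> R) (c0 c1 M : R) :
  0 <= c0 -> 0 <= c1 -> measurable_fun setT h -> measurable_fun setT phi ->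
  (forall z, 0 <= phi z) -> (forall z, 0 <= h z <= c0 + c1 * phi z) ->
  (\int[P]_z (phi z)%:E <= M%:E)%E ->
  (\int[P]_z (h z)%:E <= (c0 + c1 * M)%:E)%E.
Proof.
move=> c00 c10 mh mphi phi0 hphi phiM.
have Ephi : measurable_fun setT (fun z => (phi z)%:E) by exact/measurable_EFinP.
have m1 : measurable_fun setT (fun z => c1%:E * (phi z)%:E)%E.
  by apply: emeasurable_funM => //; exact: measurable_cst.
apply: (@le_trans _ _ (\int[P]_z (c0%:E + c1%:E * (phi z)%:E))%E).
  apply: ge0_le_integral => //.
  - by move=> z _; rewrite lee_fin; case/andP: (hphi z).
  - exact/measurable_EFinP.
  - by apply: emeasurable_funD => //; exact: measurable_cst.
  - by move=> z _; rewrite -EFinM -EFinD lee_fin; case/andP: (hphi z).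
have -> : (\int[P]_z (c0%:E + c1%:E * (phi z)%:E) =
    \int[P]_z c0%:E + \int[P]_z (c1%:E * (phi z)%:E))%E.
  apply: ge0_integralD => //.
  by move=> z _; rewrite -EFinM lee_fin mulr_ge0.
have -> : (\int[P]_z (c1%:E * (phi z)%:E) = c1%:E * \int[P]_z (phi z)%:E)%E.
  by apply: ge0_integralZl => //; move=> z _; rewrite lee_fin.
have -> : (\int[P]_z c0%:E = c0%:E)%E.
  rewrite integral_cst; last exact: measurableT.
  by rewrite [X in (_ * X)%E](probability_setT P) mule1.
rewrite EFinD leeD2l //.
by rewrite EFinM lee_wpmul2l // lee_fin.
Qed.

Definition lyapunov (R : realType) (d p : nat) (x : 'rV[R]_d) : R :=
  (1 + dotp x x) ^+ p.

Section noise.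
Context {R : realType} {d : nat}.
Implicit Types (x y sigma : 'rV[R]_d).

Lemma lyapunov_ge0 p x : 0 <= lyapunov p x.
Proof. by rewrite exprn_ge0 // addr_ge0 // dotp_ge0. Qed.

Lemma dotp_line y sigma z : dotp (y + z *: sigma) (y + z *: sigma) =
  dotp y y + 2 * dotp y sigma * z + dotp sigma sigma * z ^+ 2.
Proof. by rewrite dotpD_sqr !dotpZr !dotpZl; ring. Qed.

Lemma measurable_dotp_line y sigma :
  measurable_fun setT (fun z : R => dotp (y + z *: sigma) (y + z *: sigma)).
Proof.
under eq_fun do rewrite dotp_line.
apply: measurable_funD.
  by apply: measurable_funD => //; exact: measurable_funM.
by apply: measurable_funM => //; exact: measurable_funX.
Qed.

Lemma measurable_lyapunov_line p y sigma :
  measurable_fun setT (fun z : R => lyapunov p (y + z *: sigma)).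
Proof.
apply: measurable_funX; apply: measurable_funD => //.
exact: measurable_dotp_line.
Qed.

Lemma measurable_enorm_line y sigma :
  measurable_fun setT (fun z : R => enorm (y + z *: sigma)).
Proof.
apply: measurableT_comp (measurable_dotp_line y sigma).
by apply: continuous_measurable_fun; exact: sqrt_continuous.
Qed.

(** By the symmetry of the law, the first order term drops out and the increase is of order dt (1 +
    |y|^2)^p, one power below V; [expr_le_eps] trades it for eps dt V and a constant times dt. *)
Lemma noise_lyapunov (S dt0 eps : R) p : 0 <= S -> 0 < eps ->
  exists2 C : R, 0 <= C & forall dt, 0 < dt <= dt0 ->
    forall y sigma, dotp sigma sigma <= S ->
    (\int[normal_prob 0 (Num.sqrt dt)]_z (lyapunov p.+1 (y + z *: sigma))%:E <=
     ((1 + eps * dt) * lyapunov p.+1 y + C * dt)%:E)%E.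
Proof.
move=> S0 eps0.
have [K K0 KP] := @symmetrized_expr_le R p.
have [M M0 MP] := integral_normal_prob_even_moment dt0 p S0.
have KSM0 : 0 <= K * S * M by rewrite !mulr_ge0.
(* Chosen so that K S M del <= eps; the 1 keeps the denominator positive. *)
pose del := eps / (K * S * M + 1).
have KSM1 : 0 < K * S * M + 1 by rewrite ltr_wpDl.
have del0 : 0 < del by rewrite divr_gt0.
exists (K * S * M * del^-1 ^+ p) => [|dt dtP y sigma sS].
  by rewrite mulr_ge0 // exprn_ge0 // invr_ge0 ltW.
have dt_gt0 : 0 < dt by case/andP: dtP.
pose h z := lyapunov p.+1 (y + z *: sigma).
have mh : measurable_fun setT h by exact: measurable_lyapunov_line.
have mhE : measurable_fun setT (fun z => (h z)%:E) by exact/measurable_EFinP.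
have hE0 z : (0 <= (h z)%:E)%E by rewrite lee_fin lyapunov_ge0.
have sq0 : Num.sqrt dt != 0 by rewrite gt_eqF // sqrtr_gt0.
pose phi z : R := z ^+ 2 * (1 + S * z ^+ 2) ^+ p.
have phi0 z : 0 <= phi z.
  by rewrite mulr_ge0 ?sqr_ge0 // exprn_ge0 // addr_ge0 // mulr_ge0 // sqr_ge0.
have mphi : measurable_fun setT phi.
  apply: measurable_funM; first exact: measurable_funX.
  apply: measurable_funX; apply: measurable_funD => //.
  by apply: measurable_funM => //; exact: measurable_funX.
pose nu := normal_prob 0 (Num.sqrt dt).
set a := 1 + dotp y y.
have a1 : 1 <= a by rewrite lerDl dotp_ge0.
have a0 : 0 <= a by rewrite (le_trans _ a1).
have hs z : (h z + h (- z)) / 2 <= a ^+ p.+1 + K * S * a ^+ p * phi z.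
  rewrite /h /lyapunov !dotp_line sqrrN mulrN !addrA -/a.
  apply: le_trans (KP _ _ _ z a1 (dotp_ge0 sigma) _) _.
    rewrite exprMn (_ : 2 ^+ 2 = 4); last by ring.
    rewrite -mulrA ler_wpM2l //; apply: le_trans (dotp_CauchySchwarz _ _) _.
    by rewrite ler_wpM2r ?dotp_ge0 // /a lerDr.
  rewrite lerD2l; apply: ler_pM.
  - by rewrite !mulr_ge0 ?dotp_ge0 ?exprn_ge0.
  - rewrite mulr_ge0 ?sqr_ge0 // exprn_ge0 // addr_ge0 // mulr_ge0 ?dotp_ge0 //.
    exact: sqr_ge0.
  - by rewrite ler_wpM2r ?exprn_ge0 // ler_wpM2l.
  rewrite ler_wpM2l ?sqr_ge0 //; apply: lerXn2r.
  - by rewrite nnegrE addr_ge0 // mulr_ge0 ?dotp_ge0 ?sqr_ge0.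
  - by rewrite nnegrE addr_ge0 // mulr_ge0 ?sqr_ge0.
  by rewrite lerD2l ler_wpM2r ?sqr_ge0.
have Isym : (\int[nu]_z ((h z + h (- z)) / 2)%:E = \int[nu]_z (h z)%:E)%E.
  transitivity (\int[nu]_z ((2^-1)%:E * ((h z)%:E + (h (- z))%:E)))%E.
    by apply: eq_integral => z _; rewrite -EFinD -EFinM mulrC.
  have mhN : measurable_fun setT (fun z : R => (h (- z))%:E).
    exact: (measurableT_comp mhE (@oppr_measurable R setT)).
  have -> : (\int[nu]_z ((2^-1)%:E * ((h z)%:E + (h (- z))%:E)) =
      (2^-1)%:E * \int[nu]_z ((h z)%:E + (h (- z))%:E))%E.
    apply: ge0_integralZl.
    - exact: measurableT.
    - exact: emeasurable_funD.
    - by move=> z _; rewrite adde_ge0.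
    - by rewrite lee_fin invr_ge0.
  have -> : (\int[nu]_z ((h z)%:E + (h (- z))%:E) =
      \int[nu]_z (h z)%:E + \int[nu]_z (h (- z))%:E)%E.
    by apply: ge0_integralD.
  rewrite (integral_normal_prob_sym sq0 hE0 mhE).
  set I := (\int[nu]_z _)%E.
  by rewrite -mule2n -mule_natl muleA -EFinM mulVf ?pnatr_eq0 // mul1e.
rewrite -Isym.
apply: (@le_trans _ _ (a ^+ p.+1 + K * S * a ^+ p * (M * dt))%:E).
  apply: (@integral_affine_le _ _ _ nu _ phi).
  - by rewrite exprn_ge0.
  - by rewrite !mulr_ge0 // exprn_ge0.
  - apply: measurable_funM => //; apply: measurable_funD => //.
    exact: (measurableT_comp mh (@oppr_measurable R setT)).
  - exact: mphi.
  - exact: phi0.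
  - by move=> z; rewrite hs divr_ge0 // addr_ge0 // lyapunov_ge0.
  - exact: MP.
rewrite lee_fin /lyapunov -/a.
have := expr_le_eps p a0 del0; set X := a ^+ p.+1; set Y := a ^+ p => le1.
have -> : (1 + eps * dt) * X = X + eps * dt * X by ring.
rewrite -addrA lerD2l.
have -> : K * S * Y * (M * dt) = (K * S * M) * dt * Y by ring.
have KSMdt : 0 <= K * S * M * dt by rewrite mulr_ge0 // ltW.
apply: le_trans (ler_wpM2l KSMdt le1) _.
rewrite mulrDr; apply: lerD; last by apply: eq_ler; ring.
have X0 : 0 <= X by rewrite exprn_ge0.
have le2 : K * S * M * del <= eps.
  by rewrite /del mulrA ler_pdivrMr // mulrC ler_wpM2l // ?(ltW eps0) // lerDl.
have := ler_wpM2r (mulr_ge0 (ltW dt_gt0) X0) le2.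
rewrite [eps * (_ * _)]mulrA; apply: le_trans.
by apply: eq_ler; ring.
Qed.

(** For u = A + |y| >= 1 the power (u + S |z|)^q is at most u^q (1 + S |z|)^q, so the mean is at
    most u^(q+1) + (q+1) u^q C <= (u + C)^(q+1). An increment thus only shifts [A], a form that can
    be iterated. *)
Lemma noise_crude (S dt0 : R) q : 0 <= S ->
  exists2 C : R, 0 <= C & forall dt, 0 < dt <= dt0 ->
    forall y sigma A, enorm sigma <= S -> 1 <= A ->
    (\int[normal_prob 0 (Num.sqrt dt)]_z
        ((A + enorm (y + z *: sigma)) ^+ q.+1)%:E <=
     ((A + C + enorm y) ^+ q.+1)%:E)%E.
Proof.
move=> S0; have [C C0 CP] := integral_normal_prob_abs_moment dt0 q S0.
exists C => // dt dtP y sigma A sS A1.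
set u := A + enorm y.
have u1 : 1 <= u by rewrite ler_wpDr ?enorm_ge0.
have u0 : 0 <= u by rewrite (le_trans _ u1).
pose phi (z : R) := S * `|z| * (1 + S * `|z|) ^+ q.
apply: (@le_trans _ _ (u ^+ q.+1 + q.+1%:R * u ^+ q * C)%:E).
  apply: (@integral_affine_le _ _ _ (normal_prob 0 (Num.sqrt dt))
    (fun z => (A + enorm (y + z *: sigma)) ^+ q.+1) phi _ (q.+1%:R * u ^+ q) C).
  - by rewrite exprn_ge0.
  - by rewrite mulr_ge0 // exprn_ge0.
  - apply: measurable_funX; apply: measurable_funD => //.
    exact: measurable_enorm_line.
  - have mz : measurable_fun setT (fun z : R => S * `|z|).
      by apply: measurable_funM => //; exact: measurableT_comp.
    apply: measurable_funM => //.
    by apply: measurable_funX; exact: measurable_funD.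
  - by move=> z; rewrite mulr_ge0 ?exprn_ge0 ?addr_ge0 // mulr_ge0.
  - move=> z; apply/andP; split.
      by rewrite exprn_ge0 // addr_ge0 ?enorm_ge0 // (le_trans _ A1).
    have [t t0 tE] : exists2 t, 0 <= t & S * `|z| = t.
      by exists (S * `|z|); rewrite ?mulr_ge0.
    rewrite /phi tE; apply: (@le_trans _ _ ((u + t) ^+ q.+1)).
      apply: lerXn2r; rewrite ?nnegrE.
      + by rewrite addr_ge0 ?enorm_ge0 // (le_trans _ A1).
      + by rewrite addr_ge0.
      rewrite /u -addrA lerD2l; apply: le_trans (enormD _ _) _.
      by rewrite lerD2l enormZ -tE mulrC ler_wpM2r.
    apply: le_trans (exprD_le q u0 t0) _; rewrite lerD2l -!mulrA.
    rewrite ler_wpM2l // mulrCA ler_wpM2l // -exprMn; apply: lerXn2r.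
    + by rewrite nnegrE addr_ge0.
    + by rewrite nnegrE mulr_ge0 // addr_ge0.
    by rewrite mulrDr mulr1 lerD2l ler_peMl.
  - exact: CP.
rewrite lee_fin (_ : A + C + enorm y = u + C); last by rewrite /u; ring.
elim: q {CP phi} => [|q IH]; first by rewrite !expr1 expr0 mulr1 mul1r.
rewrite (exprS (u + C)).
have uC0 : 0 <= u + C by rewrite addr_ge0.
apply: le_trans (ler_wpM2l uC0 IH); rewrite -[q.+2]addn1 natrD addn1.
have uq0 : 0 <= u ^+ q by rewrite exprn_ge0.
have : 0 <= q.+1%:R * C * C * u ^+ q by rewrite !mulr_ge0.
by rewrite !exprS; set n := q.+1%:R; nra.
Qed.

End noise.

(** * The tamed drift *)

Section drift.
Context {R : realType} {d : nat}.
Implicit Types (x y : 'rV[R]_d) (f : 'rV[R]_d -> 'rV[R]_d) (alpha dt : R).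

Definition tamed_drift f alpha dt x : 'rV[R]_d :=
  x + (dt / (1 + alpha * dt * enorm (f x))) *: f x.

Lemma tamed_drift_enorm f alpha dt x : 0 < alpha -> 0 < dt ->
  enorm (tamed_drift f alpha dt x) <= enorm x + alpha^-1.
Proof.
move=> a0 dt0; apply: le_trans (enormD _ _) _; rewrite lerD2l enormZ.
have F0 := enorm_ge0 (f x); set F := enorm _ in F0 *.
have L0 : 0 < 1 + alpha * dt * F by rewrite ltr_pwDl // !mulr_ge0 // ltW.
rewrite ger0_norm ?divr_ge0 ?(ltW L0) ?(ltW dt0) //.
by rewrite mulrAC ler_pdivrMr // ler_pdivlMl // mulrA lerDr.
Qed.

Lemma poly_growth_sqr f k q : poly_growth f k q ->
  exists2 C : R, 0 <= C & forall x, enorm (f x) ^+ 2 <= C * lyapunov q x.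
Proof.
rewrite /poly_growth; set E := (X in ereal_sup X) => supE.
have nd0 j x : (0 <= nderive_norm f j x)%E.
  (* Zero directions witness that the supremum is over a nonempty set, so that it is not -oo. *)
  pose hs : j.-tuple 'rV[R]_d := [tuple of nseq j 0].
  apply: (@le_trans _ _ (enorm (nderive f hs x))%:E).
    by rewrite lee_fin enorm_ge0.
  apply: ereal_sup_ubound; exists hs => //= i.
  rewrite tnth_nseq -(scale0r (0 : 'rV[R]_d)) enormZ normr0 mul0r.
  exact: ler01.
have q1 x : 0 < 1 + enorm x ^+ q by rewrite ltr_wpDr ?exprn_ge0 ?enorm_ge0.
have fE x : ((enorm (f x) / (1 + enorm x ^+ q))%:E <= ereal_sup E)%E.
  apply: (le_trans _ (ereal_sup_ubound (ex_intro2 _ _ x I erefl))).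
  rewrite EFinM; apply: lee_wpmul2r.
    by rewrite lee_fin invr_ge0 ltW.
  by apply: leeDl; apply: sume_ge0 => j _; exact: nd0.
have [M ME] : exists M : R, ereal_sup E = M%:E.
  move: supE (fE 0); case: (ereal_sup E) => [M _ _|//|//].
  by exists M.
have M0 : 0 <= M.
  rewrite -lee_fin -ME; apply: le_trans (fE 0).
  by rewrite lee_fin divr_ge0 ?enorm_ge0 // ltW.
exists (4 * M ^+ 2) => [|x]; first by rewrite mulr_ge0 // sqr_ge0.
have := fE x; rewrite ME lee_fin ler_pdivrMr // => fx.
apply: (@le_trans _ _ ((M * (1 + enorm x ^+ q)) ^+ 2)).
  by apply: lerXn2r; rewrite ?nnegrE ?enorm_ge0 // mulr_ge0 // ltW.
rewrite exprMn [leRHS](_ : _ = M ^+ 2 * (4 * lyapunov q x)); last by ring.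
rewrite ler_wpM2l ?sqr_ge0 //.
have h1 : 1 <= lyapunov q x by rewrite exprn_ege1 // lerDl dotp_ge0.
have h2 : (enorm x ^+ q) ^+ 2 <= lyapunov q x.
  rewrite exprAC enorm_sqr; apply: lerXn2r.
  - by rewrite nnegrE dotp_ge0.
  - by rewrite nnegrE addr_ge0 ?dotp_ge0.
  by rewrite lerDr.
have := sqr_ge0 (enorm x ^+ q - 1).
by set u := enorm x ^+ q in h2 *; nra.
Qed.

(** Compare [x] with 0 and bound the remaining term by Young's inequality, in the form |f(0) - gamma
    x|^2 >= 0; this costs half of the dissipation 2 gamma |x|^2. *)
Lemma one_sided_growth f gamma : 0 < gamma -> one_sided_lipschitz f gamma ->
  exists2 C : R, 0 <= C & forall x,
    2 * dotp (f x) x <= C - gamma * dotp x x.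
Proof.
move=> g0 fg; exists (dotp (f 0) (f 0) / gamma) => [|x].
  by rewrite divr_ge0 ?dotp_ge0 // ltW.
have := fg 0 x; rewrite subr0 enorm_sqr => h1.
have h2 : dotp (f x) x = dotp (f x - f 0) x + dotp (f 0) x.
  by rewrite -dotpDl subrK.
have := dotp_ge0 (f 0 + (- gamma) *: x).
rewrite dotpD_sqr !dotpZr !dotpZl => h3.
rewrite h2 -(ler_pM2l g0) mulrBr [gamma * (_ / _)]mulrC divfK ?gt_eqF //.
set n := dotp x x in h1 h3 *; set m := dotp (f 0) x in h3 *.
set l := dotp (f 0) (f 0) in h3 *; set w := dotp _ x in h1 *.
have := ler_wpM2l (ltW g0) h1.
by nra.
Qed.

(** In the region dt |f|^2 <= Cf, so the taming denominator is at most [L], the effective step lam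
    lies between dt / L and dt, and lam^2 |f|^2 <= lam Cf. Hence a = 1 + |x|^2 becomes at most a -
    lam gamma a + lam C2. Half of the dissipation absorbs lam C2 when gamma a >= 2 C2; below this
    threshold V is bounded and grows by O(dt). *)
Lemma tamed_drift_lyapunov f alpha dt0 gamma Cf r p :
  0 < alpha -> 0 < dt0 -> 0 < gamma -> one_sided_lipschitz f gamma ->
  0 <= Cf -> (forall x, enorm (f x) ^+ 2 <= Cf * lyapunov r x) ->
  exists2 c : R, 0 < c & exists2 C : R, 0 <= C & forall dt, 0 < dt <= dt0 ->
    forall x, dt * lyapunov r x <= 1 ->
    lyapunov p.+1 (tamed_drift f alpha dt x) <=
    (1 - c * dt) * lyapunov p.+1 x + C * dt.
Proof.
move=> a0 dt0_gt0 g0 fg Cf0 fC.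
have [C1 C10 fC1] := one_sided_growth g0 fg.
pose L := 1 + alpha * (1 + dt0 * Cf).
have L0 : 0 < L by rewrite ltr_pwDl // mulr_ge0 ?addr_ge0 ?mulr_ge0 // ltW.
pose c := gamma / (2 * L).
have c0 : 0 < c by rewrite divr_gt0 // mulr_gt0.
pose C2 := C1 + Cf + gamma.
have C20 : 0 <= C2 by rewrite !addr_ge0 // ltW.
pose A0 := 2 * C2 / gamma.
have A00 : 0 <= A0 by rewrite divr_ge0 ?mulr_ge0 // ltW.
exists c => //.
(* The first term bounds the growth of V below the threshold [A0]; the second pays for -c dt V
   there. *)
pose C := p.+1%:R * C2 * (A0 + dt0 * C2) ^+ p + c * A0 ^+ p.+1.
have C0 : 0 <= C.
  have h : 0 <= A0 + dt0 * C2 by rewrite addr_ge0 // mulr_ge0 // ltW.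
  apply: addr_ge0; apply: mulr_ge0; rewrite ?exprn_ge0 ?(ltW c0) //.
  by rewrite mulr_ge0.
exists C => // dt /andP[dt_gt0 dt_le] x xr.
have dt_ge0 := ltW dt_gt0; have a_ge0 := ltW a0; have g_ge0 := ltW g0.
have dt0_ge0 := ltW dt0_gt0; have c_ge0 := ltW c0.
have F0 := enorm_ge0 (f x); have Fr := fC x; have wn := fC1 x.
rewrite /tamed_drift /lyapunov dotpD_sqr dotpZl !dotpZr (dotpC x (f x)).
rewrite -(enorm_sqr (f x)).
set F := enorm (f x) in F0 Fr *; set n := dotp x x in wn *.
set w := dotp _ x in wn *.
have n0 : 0 <= n by exact: dotp_ge0.
have dtF2 : dt * F ^+ 2 <= Cf.
  have := ler_wpM2l dt_ge0 Fr; move=> h; apply: le_trans h _.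
  by rewrite mulrCA ler_piMr.
have dtF : dt * F <= 1 + dt0 * Cf.
  have h : (dt * F) ^+ 2 <= dt0 * Cf.
    rewrite exprMn expr2 -mulrA; apply: ler_pM => //.
    by rewrite mulr_ge0 // sqr_ge0.
  by have := sqr_ge0 (dt * F - 1); nra.
set lam := dt / _.
have D0 : 0 < 1 + alpha * dt * F by rewrite ltr_pwDl // !mulr_ge0.
have lam0 : 0 <= lam by rewrite divr_ge0 // ltW.
have lam_dt : lam <= dt.
  by rewrite ler_pdivrMr // ler_peMr // lerDl !mulr_ge0.
have lam_L : dt <= lam * L.
  rewrite /lam mulrAC ler_pdivlMr // ler_wpM2l // lerD2l -mulrA.
  by rewrite ler_wpM2l.
have lamF : lam * F ^+ 2 <= Cf.
  by apply: le_trans dtF2; rewrite ler_wpM2r // sqr_ge0.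
clearbody lam.
set a := 1 + n; set b := 1 + _.
have a1 : 1 <= a by rewrite lerDl.
have ba : b <= a - lam * gamma * a + lam * C2.
  have h1 := ler_wpM2l lam0 wn; have h2 := ler_wpM2l lam0 lamF.
  by rewrite /b /a /C2; clear - h1 h2; nra.
have b1 : 1 <= b.
  rewrite /b lerDl; have := dotp_ge0 (x + lam *: f x).
  by rewrite dotpD_sqr dotpZl !dotpZr -(enorm_sqr (f x)) (dotpC x (f x)).
have b0 : 0 <= b by rewrite (le_trans _ b1).
have a_gt0 : 0 < a by rewrite (lt_le_trans _ a1).
have a_nn := ltW a_gt0.
have lamc : c * dt <= lam * gamma / 2.
  have := ler_wpM2l c_ge0 lam_L; congr (_ <= _).
  by rewrite /c; field; rewrite gt_eqF.
have [big|small] := leP (2 * C2) (gamma * a).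
  set k := 1 - lam * gamma / 2.
  have bk : b <= k * a.
    by apply: le_trans ba _; have := ler_wpM2l lam0 big; rewrite /k; lra.
  (* The sign needs no smallness of dt: it follows from 1 <= b <= k a. *)
  have k0 : 0 <= k.
    by rewrite -(pmulr_lge0 _ a_gt0) (le_trans _ bk).
  have k1 : k <= 1.
    by rewrite /k gerBl divr_ge0 // mulr_ge0.
  apply: (@le_trans _ _ ((k * a) ^+ p.+1)); first by apply: lerXn2r; rewrite ?nnegrE // mulr_ge0.
  rewrite exprMn; apply: ler_wpDr.
    by rewrite mulr_ge0.
  rewrite ler_wpM2r ?exprn_ge0 //; apply: (@le_trans _ _ k).
    by rewrite exprS ler_piMr // exprn_ile1.
  by rewrite /k lerD2l lerN2.
have aA : a <= A0 by rewrite ler_pdivlMr // mulrC ltW.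
have le1 : b <= a + dt * C2.
  apply: le_trans ba _; have := ler_wpM2r C20 lam_dt.
  have : 0 <= lam * gamma * a by rewrite !mulr_ge0.
  by lra.
have le2 : b ^+ p.+1 <= (a + dt * C2) ^+ p.+1.
  by apply: lerXn2r; rewrite ?nnegrE // addr_ge0 // mulr_ge0.
apply: le_trans le2 _.
have dC0 : 0 <= dt * C2 by rewrite mulr_ge0.
apply: le_trans (exprD_le p a_nn dC0) _.
have le3 : (a + dt * C2) ^+ p <= (A0 + dt0 * C2) ^+ p.
  apply: lerXn2r; rewrite ?nnegrE ?addr_ge0 // ?mulr_ge0 //.
  by rewrite lerD // ler_wpM2r.
have le4 : a ^+ p.+1 <= A0 ^+ p.+1 by apply: lerXn2r; rewrite ?nnegrE.
have := ler_wpM2l (mulr_ge0 (ler0n R p.+1) dC0) le3.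
have := ler_wpM2l (mulr_ge0 c_ge0 dt_ge0) le4.
set X := a ^+ p.+1; set X0 := A0 ^+ p.+1; set Y := (a + _) ^+ p.
set Y0 := (A0 + _) ^+ p; set n1 := p.+1%:R.
by move=> h1 h2; rewrite /C -/X0 -/Y0 -/n1; lra.
Qed.

End drift.

(** * Measurability of vector-valued maps *)

Section measurable_vectors.
Context disp (T : measurableType disp) (R : realType) (d : nat).
Implicit Types (g h : T -> 'rV[R]_d) (f : 'rV[R]_d -> 'rV[R]_d).

(** Coordinatewise measurability stands in for Borel measurability; [measurable_open_preimage] links
    the two. *)
Definition measurable_vector g : Prop :=
  forall i, measurable_fun setT (fun w => g w 0 i).

Lemma measurable_vector_cst x : measurable_vector (fun=> x).
Proof. by move=> i; exact: measurable_cst. Qed.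

Lemma measurable_vectorD g h : measurable_vector g -> measurable_vector h ->
  measurable_vector (fun w => g w + h w).
Proof.
move=> mg mh i; under eq_fun do rewrite mxE.
exact: measurable_funD.
Qed.

Lemma measurable_vectorZ (a : T -> R) g : measurable_fun setT a ->
  measurable_vector g -> measurable_vector (fun w => a w *: g w).
Proof.
move=> ma mg i; under eq_fun do rewrite mxE.
exact: measurable_funM.
Qed.

Lemma measurable_vector_sum (I : Type) (s : seq I) (P : pred I)
    (g : I -> T -> 'rV[R]_d) : (forall k, P k -> measurable_vector (g k)) ->
  measurable_vector (fun w => \sum_(k <- s | P k) g k w).
Proof.
move=> mg; elim: s => [|k s IH].
  by under eq_fun do rewrite big_nil; exact: measurable_vector_cst.
under eq_fun do rewrite big_cons.
have [Pk|_] := boolP (P k); last exact: IH.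
by apply: measurable_vectorD => //; exact: mg.
Qed.

Lemma measurable_dotp g h : measurable_vector g -> measurable_vector h ->
  measurable_fun setT (fun w => dotp (g w) (h w)).
Proof.
by move=> mg mh; apply: measurable_sum => i; exact: measurable_funM.
Qed.

Lemma measurable_enorm g : measurable_vector g ->
  measurable_fun setT (fun w => enorm (g w)).
Proof.
move=> mg; apply: measurableT_comp (measurable_dotp mg mg).
by apply: continuous_measurable_fun; exact: sqrt_continuous.
Qed.

(* An open set is the countable union of the sup norm balls with rational
   centres that it contains. *)
Lemma measurable_open_preimage g (O : set 'rV[R]_d) :
  measurable_vector g -> open O -> measurable (g @^-1` O).
Proof.
move=> mg oO.
pose B (vn : 'rV[rat]_d * nat) : set 'rV[R]_d :=
  ball (map_mx ratr vn.1 : 'rV[R]_d) (vn.2.+1%:R^-1 : R).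
pose F vn := if pselect (B vn `<=` O) then g @^-1` B vn else set0.
have -> : g @^-1` O = \bigcup_vn F vn.
  apply/seteqP; split=> [w Ow|w [vn _]]; last first.
    by rewrite /F; case: pselect => // sBO Bw; exact: (sBO _ Bw).
  have /nbhs_ballP[e /= e0 eO] : nbhs (g w) O by exact: open_nbhs_nbhs.
  have [n ne] : exists n, n.+1%:R^-1 < e / 2 :> R.
    exists (Num.truncn (e / 2)^-1).
    by rewrite invf_plt ?posrE ?divr_gt0 // truncnS_gt.
  set q : R := n.+1%:R^-1 in ne.
  have q0 : 0 < q by rewrite invr_gt0.
  have /choice[v vE] (i : 'I_d) : exists r : rat, ratr r \in `]g w 0 i - q, g w 0 i + q[.
    by apply: rat_in_itvoo; rewrite ltrD2l gtrN.
  have vg : ball (map_mx ratr (\row_i v i) : 'rV[R]_d) q (g w).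
    split=> // i j; rewrite !mxE (ord1 i) -ball_normE /ball_ /=.
    have := vE j; rewrite in_itv /= => /andP[h1 h2].
    by rewrite ltr_norml; apply/andP; split; lra.
  exists (\row_i v i, n) => //; rewrite /F; case: pselect => // -[].
  move=> y vy; apply: eO; apply: (@le_ball _ _ _ (q + q)); first by lra.
  by apply: ball_triangle vy; exact: ball_sym.
apply: countable_bigcupT_measurable; first exact: countableP.
move=> [v n]; rewrite /F; case: pselect => [sBO|?]; last exact: measurable0.
have -> : g @^-1` B (v, n) = \bigcap_(i in [set: 'I_d])
    (fun w => g w 0 i) @^-1` ball (ratr (v 0 i) : R) (n.+1%:R^-1 : R).
  apply/seteqP; split=> [w [_ Bw] i _ /=|w Bw].
    by have := Bw 0 i; rewrite mxE.
  by split=> [|i j]; [rewrite /= invr_gt0 | rewrite (ord1 i) mxE; exact: Bw].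
apply: fin_bigcap_measurable; first exact: finite_finset.
move=> i _; rewrite -[X in measurable X]setTI; apply: mg => //.
exact: open_measurable (ball_open _ _).
Qed.

Lemma measurable_continuous_vector f g : continuous f ->
  measurable_vector g -> measurable_vector (fun w => f (g w)).
Proof.
move=> cf mg i; apply: (measurability _ (RGenOpens.measurableE R)).
move=> _ [_ [a [b ->] <-]]; rewrite setTI.
pose O := (fun x => f x 0 i) @^-1` `]a, b[%classic.
have oO : open O.
  apply: open_comp; last exact: interval_open.
  move=> x _; apply: (@continuous_comp _ _ _ f (fun y : 'rV[R]_d => y 0 i)).
    exact: cf.
  exact: coord_continuous.
exact: (measurable_open_preimage mg oO).
Qed.

End measurable_vectors.

(** * The potential *)

Section potential.
Context {R : realType}.
Variables (d q p : nat).
Implicit Types (x y sigma : 'rV[R]_d) (A a b : R).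

Definition potential A a b x : R :=
  Num.min ((A + enorm x) ^+ q.+1) (a * lyapunov p.+1 x + b).

Lemma potential_ge0 A a b x : 0 <= A -> 0 <= a -> 0 <= b ->
  0 <= potential A a b x.
Proof.
move=> A0 a0 b0; rewrite /potential le_min exprn_ge0 ?addr_ge0 ?enorm_ge0 //=.
by rewrite mulr_ge0 // lyapunov_ge0.
Qed.

Lemma measurable_potential disp (T : measurableType disp) A a b
    (g : T -> 'rV[R]_d) : measurable_vector g ->
  measurable_fun setT (fun w => potential A a b (g w)).
Proof.
move=> mg; apply: measurable_minr.
  apply: measurable_funX; apply: measurable_funD => //.
  exact: measurable_enorm.
apply: measurable_funD => //; apply: measurable_funM => //.
apply: measurable_funX; apply: measurable_funD => //.
exact: measurable_dotp.
Qed.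

(** The integral of the minimum is below the integral of each branch, so [noise_crude] updates [A]
    and [noise_lyapunov] updates [a] and [b] independently of each other. *)
Lemma noise_potential (S dt0 eps : R) : 0 <= S -> 0 < eps ->
  exists2 kap : R, 0 <= kap & exists2 C : R, 0 <= C &
  forall dt, 0 < dt <= dt0 -> forall y sigma, enorm sigma <= S ->
  forall A a b, 1 <= A -> 0 <= a -> 0 <= b ->
  (\int[normal_prob 0 (Num.sqrt dt)]_z (potential A a b (y + z *: sigma))%:E <=
   (potential (A + kap) (a * (1 + eps * dt)) (b + a * C * dt) y)%:E)%E.
Proof.
move=> S0 eps0.
have [kap kap0 kapP] := @noise_crude R d S dt0 q S0.
have [C C0 CP] := @noise_lyapunov R d (S ^+ 2) dt0 eps p (sqr_ge0 S) eps0.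
exists kap => //; exists C => // dt dtP y sigma sS A a b A1 a0 b0.
have A0 : 0 <= A by rewrite (le_trans _ A1).
have mline : measurable_vector (fun z : R => y + z *: sigma).
  apply: measurable_vectorD; first exact: measurable_vector_cst.
  by apply: measurable_vectorZ => //; exact: measurable_vector_cst.
have mpot : measurable_fun setT
    (fun z : R => (potential A a b (y + z *: sigma))%:E).
  by apply/measurable_EFinP; exact: measurable_potential.
have pot0 z : (0 <= (potential A a b (y + z *: sigma))%:E)%E.
  by rewrite lee_fin potential_ge0.
rewrite [X in (_ <= X%:E)%E]/potential EFin_min le_min; apply/andP; split.
  apply: le_trans (kapP dt dtP y sigma A sS A1).
  apply: ge0_le_integral => //.
  - apply/measurable_EFinP; apply: measurable_funX; apply: measurable_funD => //.
    exact: measurable_enorm_line.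
  - by move=> z _; rewrite lee_fin ge_min lexx.
have ss : dotp sigma sigma <= S ^+ 2.
  by rewrite -enorm_sqr; apply: lerXn2r; rewrite ?nnegrE ?enorm_ge0.
have h := CP dt dtP y sigma ss.
have -> : a * (1 + eps * dt) * lyapunov p.+1 y + (b + a * C * dt) =
    b + a * ((1 + eps * dt) * lyapunov p.+1 y + C * dt) by ring.
apply: (@integral_affine_le _ _ _ (normal_prob 0 (Num.sqrt dt)) _
  (fun z => lyapunov p.+1 (y + z *: sigma))) h => //.
- exact: measurable_potential.
- exact: measurable_lyapunov_line.
- by move=> z; exact: lyapunov_ge0.
- move=> z; rewrite potential_ge0 //=.
  by rewrite ge_min [b + _]addrC lexx orbT.
Qed.

End potential.

(** * Decrease of the potential along a full step *)

Section scheme_potential.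
Context {R : realType}.
Variables (d K : nat) (f : 'rV[R]_d -> 'rV[R]_d) (sigma : 'I_K -> 'rV[R]_d).
Variables (alpha dt0 gamma Cf : R) (r q p : nat).
Hypotheses (alpha_gt0 : 0 < alpha) (dt0_gt0 : 0 < dt0) (gamma_gt0 : 0 < gamma).
Hypothesis f_one_sided : one_sided_lipschitz f gamma.
Hypothesis Cf_ge0 : 0 <= Cf.
Hypothesis f_growth : forall x, enorm (f x) ^+ 2 <= Cf * lyapunov r x.
Hypothesis pE : p.+1 = (r.+1 * q.+1)%N.

(* [C1] bounds the growth per step of the crude bound and [C2] that of the
   Lyapunov bound; [Phi j i] is the potential with [j] full steps and [i] noise
   increments to go. *)
Lemma scheme_potential : exists2 C1 : R, 0 <= C1 & exists2 C2 : R, 0 <= C2 &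
  forall dt, 0 < dt <= dt0 -> forall T, 0 < T ->
  let a := (2 + C1 * T) ^+ q.+1 in
  exists A : nat -> nat -> R, exists B : nat -> nat -> R,
  exists D : nat -> nat -> R, let Phi j i := potential q p (A j i) (B j i) (D j i) in
  [/\ forall j i, [/\ 1 <= A j i, 0 <= B j i & 0 <= D j i],
      forall j i y k, (i < K)%N ->
        (\int[normal_prob 0 (Num.sqrt dt)]_z (Phi j i (y + z *: sigma k))%:E <=
         (Phi j i.+1 y)%:E)%E,
      forall j x, j.+1%:R * dt <= T ->
        Phi j K (tamed_drift f alpha dt x) <= Phi j.+1 0%N x,
      forall x, Phi 0%N 0%N x = (1 + enorm x) ^+ q.+1 &
      forall j x, j%:R * dt <= T ->
        Phi j 0%N x <= a * (lyapunov p.+1 x + C2 * T)].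
Proof.
pose S := \sum_k enorm (sigma k).
have S0 : 0 <= S by apply: sumr_ge0 => k _; exact: enorm_ge0.
have sS k : enorm (sigma k) <= S.
  by rewrite /S (bigD1 k) //= lerDl sumr_ge0 // => l _; exact: enorm_ge0.
have [c c0 [Cd Cd0 driftP]] := @tamed_drift_lyapunov R d f alpha dt0 gamma Cf r p
  alpha_gt0 dt0_gt0 gamma_gt0 f_one_sided Cf_ge0 f_growth.
pose eps := c / K.+1%:R.
have eps0 : 0 < eps by rewrite divr_gt0.
have [kap kap0 [Cn Cn0 noiseP]] := @noise_potential R d q p S dt0 eps S0 eps0.
have eps_ge0 := ltW eps0; have dt0_ge0 := ltW dt0_gt0; have c_ge0 := ltW c0.
pose G := (1 + eps * dt0) ^+ K.
have G0 : 0 <= G by rewrite exprn_ge0 // addr_ge0 // mulr_ge0.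
pose C1 := alpha^-1 + K%:R * kap.
have ialpha0 : 0 <= alpha^-1 by rewrite invr_ge0 ltW.
have C10 : 0 <= C1 by rewrite addr_ge0 // mulr_ge0.
(* The additive terms of the K increments and of the drift, each multiplied by at most [G], which
   bounds the growth factors of V uniformly in dt. *)
pose C2 := K%:R * (G * Cn) + G * Cd.
have C20 : 0 <= C2.
  by apply: addr_ge0; rewrite mulr_ge0 // mulr_ge0.
exists C1 => //; exists C2 => // dt /[dup] dtP /andP[dt_gt0 dt_le] T T0 a.
have dt_ge0 := ltW dt_gt0; have T_ge0 := ltW T0.
have CT0 : 0 <= 2 + C1 * T by rewrite addr_ge0 // mulr_ge0.
have a0 : 0 <= a by rewrite exprn_ge0.
have e1 : 1 <= 1 + eps * dt by rewrite lerDl mulr_ge0.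
have e0 : 0 <= 1 + eps * dt by rewrite (le_trans _ e1).
pose g i := (1 + eps * dt) ^+ i.
have g0 i : 0 <= g i by rewrite exprn_ge0.
have gG i : (i <= K)%N -> g i <= G.
  move=> iK; apply: (@le_trans _ _ (g K)); first exact: ler_weXn2l.
  apply: lerXn2r; rewrite ?nnegrE //; first by rewrite addr_ge0 // mulr_ge0.
  by rewrite lerD2l ler_wpM2l.
(* The choice of [eps] makes the contraction of the drift absorb the growth
   caused by the [K] noise increments. *)
have contr : g K * (1 - c * dt) <= 1.
  have [neg|pos] := leP (1 - c * dt) 0.
    by apply: le_trans ler01; rewrite mulr_ge0_le0.
  apply: (@le_trans _ _ (expR (c * dt) * expR (- (c * dt)))); last first.
    by rewrite -expRD subrr expR0.
  apply: ler_pM => //; first exact: ltW.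
    apply: (@le_trans _ _ (expR (eps * dt) ^+ K)).
      by apply: lerXn2r; rewrite ?nnegrE ?expR_ge0 // expR_ge1Dx.
    rewrite -expRM_natl ler_expR mulrA ler_wpM2r //.
    rewrite /eps mulrCA ler_piMr // ler_pdivrMr // mul1r ler_nat.
    exact: leqnSn.
  exact: expR_ge1Dx.
(* [B] does not depend on j, because a drift step cancels the factor gained over the K increments;
   only [D] grows, linearly in j, and so the final bound is polynomial in [T]. *)
pose A j i : R := 1 + j%:R * C1 + i%:R * kap.
pose B (j i : nat) : R := a * g i.
pose D j i : R := j%:R * (a * C2 * dt) + i%:R * (a * G * Cn * dt).
have A1 j i : 1 <= A j i.
  by rewrite /A -addrA lerDl addr_ge0 // mulr_ge0.
have B0 j i : 0 <= B j i by rewrite mulr_ge0.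
have aCn0 : 0 <= a * G * Cn * dt by rewrite !mulr_ge0.
have aC20 : 0 <= a * C2 * dt by rewrite !mulr_ge0.
have D0 j i : 0 <= D j i.
  by apply: addr_ge0; rewrite mulr_ge0.
have lyap0 (x : 'rV[R]_d) : 0 <= lyapunov p.+1 x by exact: lyapunov_ge0.
(* The base A' + |x| is at most (2 + C1 T) (1 + |x|^2)^(r+1); its power q + 1 is a V(x), which
   dictates both [a] and [pE]. It serves with Q = 1 / dt outside the region and with Q = 0 when no
   step remains. *)
have crude A' (x : 'rV[R]_d) Q : 1 <= A' -> A' <= 1 + C1 * T * Q -> Q <= lyapunov r x -> 0 <= Q ->
    (A' + enorm x) ^+ q.+1 <= a * lyapunov p.+1 x.
  move=> A'1 A'Q Qr Q0; rewrite /a /lyapunov pE exprM -exprMn.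
  have l1 : 1 <= 1 + dotp x x by rewrite lerDl dotp_ge0.
  have l0 : 0 <= 1 + dotp x x by rewrite (le_trans _ l1).
  have r0 : 0 <= (1 + dotp x x) ^+ r.+1 by rewrite exprn_ge0.
  apply: lerXn2r; rewrite ?nnegrE.
  - by rewrite addr_ge0 ?enorm_ge0 // (le_trans _ A'1).
  - by rewrite mulr_ge0.
  have r1 : (1 + dotp x x) <= (1 + dotp x x) ^+ r.+1.
    by rewrite exprS ler_peMr // exprn_ege1.
  have Qr1 : Q <= (1 + dotp x x) ^+ r.+1.
    by apply: le_trans Qr _; rewrite /lyapunov exprS ler_peMl // exprn_ge0.
  have := ler_wpM2l (mulr_ge0 C10 T_ge0) Qr1.
  have : enorm x <= 1 + dotp x x.
    by rewrite -enorm_sqr; have := sqr_ge0 (enorm x - 1); nra.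
  by lra.
exists A, B, D => /=; split.
- by move=> j i; split.
- move=> j i y k iK.
  apply: le_trans (noiseP dt dtP y (sigma k) (sS k) _ _ _ (A1 j i) (B0 j i) (D0 j i)) _.
  have -> : A j i + kap = A j i.+1 by rewrite /A -natr1; ring.
  have -> : B j i * (1 + eps * dt) = B j i.+1 by rewrite /B /g exprSr mulrA.
  rewrite lee_fin /potential le_min !ge_min lexx /=; apply/orP; right.
  rewrite lerD2l /D -natr1 mulrDl mul1r addrA lerD2l ler_wpM2r //.
  by rewrite ler_wpM2r // /B ler_wpM2l // gG // ltnW.
- move=> j x jT.
  have -> : B j.+1 0%N = a by rewrite /B /g expr0 mulr1.
  set x' := tamed_drift _ _ _ _.
  have part1 : (A j K + enorm x') ^+ q.+1 <= (A j.+1 0%N + enorm x) ^+ q.+1.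
    apply: lerXn2r; rewrite ?nnegrE.
    + by rewrite addr_ge0 ?enorm_ge0 // (le_trans _ (A1 _ _)).
    + by rewrite addr_ge0 ?enorm_ge0 // (le_trans _ (A1 _ _)).
    have := tamed_drift_enorm f x alpha_gt0 dt_gt0; rewrite -/x'.
    rewrite /A /C1 -natr1; lra.
  rewrite [leRHS]/potential le_min; apply/andP; split.
    by rewrite /potential ge_min part1.
  have [inside|outside] := leP (dt * lyapunov r x) 1.
    rewrite /potential ge_min; apply/orP; right.
    have h1 := ler_wpM2l (B0 j K) (driftP dt dtP x inside).
    have h2 := ler_wpM2r (lyap0 x) (ler_wpM2l a0 contr).
    have h3 := ler_wpM2r (mulr_ge0 Cd0 dt_ge0) (ler_wpM2l a0 (gG K (leqnn K))).
    rewrite /B in h1 *; rewrite /D -natr1 mul0r addr0 /C2; lra.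
  (* Outside, 1 / dt < (1 + |x|^2)^r while j + 1 <= T / dt, so the crude bound is already below a
     V(x), without any contraction. *)
  rewrite /potential ge_min; apply/orP; left; apply: le_trans part1 _.
  apply: ler_wpDr => //; apply: (crude _ _ (dt^-1)) => //.
  + rewrite /A mul0r addr0 lerD2l [leLHS]mulrC -[leRHS]mulrA ler_wpM2l //.
    by rewrite ler_pdivlMr.
  + by rewrite -[leLHS]mul1r ler_pdivrMr // mulrC ltW.
  + by rewrite invr_ge0.
- move=> x; rewrite /potential /A /D /B /g expr0 !mul0r !addr0 mulr1.
  apply/min_idPl; apply: (crude _ _ 0) => //; last exact: lyapunov_ge0.
  by rewrite mulr0 addr0.
- move=> j x jT; rewrite /potential ge_min; apply/orP; right.
  rewrite /B /g expr0 mulr1 mulrDr lerD2l /D mul0r addr0.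
  have := ler_wpM2l (mulr_ge0 a0 C20) jT; lra.
Qed.

End scheme_potential.

(** * The mean of the potential along the scheme *)

Lemma measurable_tamed_drift disp (T : measurableType disp) (R : realType)
    (d : nat) (f : 'rV[R]_d -> 'rV[R]_d) (alpha dt : R) (g : T -> 'rV[R]_d) :
  0 < alpha -> 0 < dt -> continuous f -> measurable_vector g ->
  measurable_vector (fun w => tamed_drift f alpha dt (g w)).
Proof.
move=> a0 dt0 cf mg; have mfg := measurable_continuous_vector cf mg.
apply: measurable_vectorD => //; apply: measurable_vectorZ => //.
apply: measurable_funM => //.
(* The denominator is at least 1, so its inverse is a real power, which is a measurable function. *)
have -> : (fun w => (1 + alpha * dt * enorm (f (g w)))^-1) =
    (fun w => (1 + alpha * dt * enorm (f (g w))) `^ (-1)).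
  apply/funext => w; rewrite powR_inv1 // addr_ge0 //.
  by rewrite !mulr_ge0 ?enorm_ge0 // ltW.
apply: (measurableT_comp (@measurable_powR R (-1))).
apply: measurable_funD => //; apply: measurable_funM => //.
exact: measurable_enorm.
Qed.

Section scheme.
Context {R : realType}.
Variables (d K : nat) (f : 'rV[R]_d -> 'rV[R]_d) (sigma : 'I_K -> 'rV[R]_d).
Variables (alpha dt : R) (x0 : 'rV[R]_d).
Hypotheses (alpha_gt0 : 0 < alpha) (dt_gt0 : 0 < dt) (f_cont : continuous f).

Definition increment (Omega : Type) (W : 'I_K -> R -> Omega -> R) (n : nat)
    (k : 'I_K) (w : Omega) : R :=
  W k (n.+1%:R * dt) w - W k (n%:R * dt) w.

Definition partial_step (Omega : Type) (W : 'I_K -> R -> Omega -> R)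
    (n i : nat) (w : Omega) : 'rV[R]_d :=
  tamed_drift f alpha dt (tamed_euler f sigma alpha W dt x0 n w) +
  \sum_(k < K | (k < i)%N) increment W n k w *: sigma k.

Lemma partial_step0 (Omega : Type) (W : 'I_K -> R -> Omega -> R) n w :
  partial_step W n 0%N w =
  tamed_drift f alpha dt (tamed_euler f sigma alpha W dt x0 n w).
Proof. by rewrite /partial_step big_pred0 ?addr0. Qed.

Lemma partial_stepS (Omega : Type) (W : 'I_K -> R -> Omega -> R) n (k : 'I_K) w :
  partial_step W n k.+1 w =
  partial_step W n k w + increment W n k w *: sigma k.
Proof.
rewrite /partial_step [in LHS](bigD1 k) //= [_ *: _ + _]addrC addrA.
congr (_ + _ + _); apply: eq_bigl => l.
by rewrite ltnS -(inj_eq val_inj) /= ltn_neqAle andbC.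
Qed.

Lemma partial_stepK (Omega : Type) (W : 'I_K -> R -> Omega -> R) n w :
  partial_step W n K w = tamed_euler f sigma alpha W dt x0 n.+1 w.
Proof.
rewrite /partial_step /=; congr (_ + _); apply: eq_bigl => k.
by rewrite ltn_ord.
Qed.

Lemma measurable_tamed_euler disp (T : measurableType disp)
    (W : 'I_K -> R -> T -> R) n :
  (forall j k, (j < n)%N -> measurable_fun setT (increment W j k)) ->
  measurable_vector (tamed_euler f sigma alpha W dt x0 n).
Proof.
elim: n => [_|n IH mW]; first exact: measurable_vector_cst.
apply: measurable_vectorD.
  apply: measurable_tamed_drift => //; apply: IH => j k jn.
  by apply: mW; rewrite ltnS ltnW.
apply: measurable_vector_sum => k _; apply: measurable_vectorZ.
  exact: mW.
exact: measurable_vector_cst.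
Qed.

(** The source space is arbitrary and only the increments already added are assumed measurable: on
    the sigma-algebra of the past this expresses that the scheme is adapted. *)
Lemma measurable_partial_step disp (T : measurableType disp)
    (W : 'I_K -> R -> T -> R) n i :
  (forall j (k : 'I_K), (j < n)%N || ((j == n) && (k < i)%N) ->
    measurable_fun setT (increment W j k)) ->
  measurable_vector (partial_step W n i).
Proof.
move=> mW; apply: measurable_vectorD.
  apply: measurable_tamed_drift => //; apply: measurable_tamed_euler => j k jn.
  by apply: mW; rewrite jn.
apply: measurable_vector_sum => k ki; apply: measurable_vectorZ.
  by apply: mW; rewrite eqxx ki orbT.
exact: measurable_vector_cst.
Qed.

Variables (disp : measure_display) (Omega : measurableType disp).
Variables (P : probability Omega R) (beta : 'I_K -> R -> {RV P >-> R}).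
Hypothesis beta_wiener : forall k, wiener_process P (beta k).
Hypothesis beta_independent : independent_processes P beta.

Let W : 'I_K -> R -> Omega -> R := beta.

Lemma measurable_increment n k : measurable_fun setT (increment W n k).
Proof. by apply: measurable_funB; exact: measurable_funP. Qed.

Let noise N (jk : 'I_N * 'I_K) : {mfun Omega >-> R} :=
  mfun_Sub (mem_set (measurable_increment jk.1 jk.2)).

(** Independence of the processes splits the probability over k, and independence of the increments
    of each process splits it over time. *)
Lemma noise_law N (B : 'I_N * 'I_K -> set R) : (forall i, measurable (B i)) ->
  P (\bigcap_(i in [set: 'I_N * 'I_K]) noise i @^-1` B i) =
  (\prod_i normal_prob 0 (Num.sqrt dt) (B i))%E.
Proof.
move=> mB.
pose E k := \bigcap_(j in [set: 'I_N]) increment W j k @^-1` B (j, k).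
have -> : \bigcap_(i in [set: 'I_N * 'I_K]) noise i @^-1` B i =
    \bigcap_(k in [set: 'I_K]) E k.
  apply/seteqP; split=> [w wB k _ j _|w wB [j k] _]; first exact: (wB (j, k)).
  exact: (wB k I j I).
rewrite beta_independent => [|k].
  rewrite (eq_bigr (fun k => \prod_(j < N) normal_prob 0 (Num.sqrt dt) (B (j, k)))%E).
    rewrite exchange_big /= pair_bigA /=.
    by apply: eq_bigr => -[j k].
  move=> k _; have [_ _ law indep] := beta_wiener k.
  pose t (i : nat) := i%:R * dt.
  have t_ge0 i : 0 <= t i by rewrite mulr_ge0 // ltW.
  have t_homo : {homo t : i j / (i <= j)%N >-> i <= j}.
    by move=> i j ij; rewrite ler_wpM2r ?ler_nat // ltW.
  rewrite (indep N t (t_ge0 0%N) t_homo) => [|j]; last by exists (B (j, k)).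
  apply: eq_bigr => j _.
  have tt : t j < t j.+1 by rewrite ltr_pM2r // ltr_nat.
  have := law (t j) (t j.+1) (t_ge0 j) tt (B (j, k)) (mB (j, k)).
  rewrite (_ : t j.+1 - t j = dt) //.
  by rewrite /t -mulrBl -natr1 addrAC subrr add0r mul1r.
(* It remains to see that [E k] is an event of the k-th process: its increments are measurable for
   the sigma-algebra generated by the process. *)
pose H : set (set Omega) := \bigcup_(t in [set t | 0 <= t]) rv_events (beta k t).
have mW t : 0 <= t ->
    measurable_fun [set: g_sigma_algebraType H] (beta k t : g_sigma_algebraType H -> R).
  move=> t0 _ C mC; rewrite setTI; apply: sub_sigma_algebra.
  by exists t => //; exists C.
rewrite /process_events -/H.
suff : measurable (E k : set (g_sigma_algebraType H)) by [].
apply: fin_bigcap_measurable; first exact: finite_finset.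
move=> j _; rewrite -[X in measurable X]setTI.
have mD : measurable_fun [set: g_sigma_algebraType H]
    (increment W j k : g_sigma_algebraType H -> R).
  by apply: measurable_funB; apply: mW; rewrite mulr_ge0 // ltW.
exact: mD.
Qed.

Variable Phi : nat -> nat -> 'rV[R]_d -> R.
Hypothesis Phi_ge0 : forall j i x, 0 <= Phi j i x.
Hypothesis Phi_measurable : forall disp' (T : measurableType disp')
  (g : T -> 'rV[R]_d) j i,
  measurable_vector g -> measurable_fun setT (fun w => Phi j i (g w)).
Hypothesis Phi_noise : forall j i y k, (i < K)%N ->
  (\int[normal_prob 0 (Num.sqrt dt)]_z (Phi j i (y + z *: sigma k))%:E <=
   (Phi j i.+1 y)%:E)%E.

Lemma expectation_noise_step j n (k : 'I_K) i : (i < K)%N ->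
  (\int[P]_w (Phi j i (partial_step W n k.+1 w))%:E <=
   \int[P]_w (Phi j i.+1 (partial_step W n k w))%:E)%E.
Proof.
move=> iK.
(* The increments strictly before (n, k), ordered by time and then by component. *)
pose J (jk : 'I_n.+1 * 'I_K) := (jk.1 < n)%N || ((jk.1 == n :> nat) && (jk.2 < k)%N).
pose H := history (@noise n.+1) J.
pose T' := g_sigma_algebraType H.
pose i0 : 'I_n.+1 * 'I_K := (ord_max, k).
have Ji0 : ~~ J i0 by rewrite /J /= !ltnn andbF.
pose nu : probability (measurableTypeR R) R := normal_prob 0 (Num.sqrt dt).
have indep := @history_independent _ _ _ P _ (@noise n.+1)
  nu J i0 (probability_setT nu) (@noise_law n.+1) Ji0.
have HM : <<s H >> `<=` measurable.
  apply: smallest_sub; first exact: sigma_algebra_measurable.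
  exact: history_measurable.
have mid : measurable_fun [set: Omega] (idfun : Omega -> T').
  by move=> _ A mA; rewrite setTI; exact: HM.
(* The past is represented by the identity into [Omega] with the coarser sigma-algebra, so the joint
   law of the earlier increments need not be handled as a vector. *)
pose Xid : {mfun Omega >-> T'} := mfun_Sub (mem_set mid).
have minc l (m : 'I_K) : (l < n)%N || ((l == n) && (m < k)%N) ->
    measurable_fun [set: T'] (increment W l m : T' -> R).
  move=> lm _ C mC; rewrite setTI; apply: sub_sigma_algebra.
  have ln : (l < n.+1)%N by case/orP: lm => [/ltnW //|/andP[/eqP -> _]].
  exact: (@history_coordinate _ _ _ _ (@noise n.+1) J (Ordinal ln, m)).
have mY : measurable_vector (partial_step W n k : T' -> 'rV[R]_d).
  exact: measurable_partial_step.
have mZ : measurable_fun [set: Omega] (increment W n k : Omega -> measurableTypeR R).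
  exact: measurable_increment.
pose Z : {mfun Omega >-> measurableTypeR R} :=
  @mfun_Sub _ _ Omega (measurableTypeR R) _ (mem_set mZ).
pose h (wz : T' * measurableTypeR R) : \bar R := (Phi j i (partial_step W n k wz.1 + wz.2 *: sigma k))%:E.
have mh : measurable_fun [set: T' * measurableTypeR R] h.
  apply/measurable_EFinP; apply: Phi_measurable.
  apply: measurable_vectorD.
    by move=> l; apply: measurableT_comp (mY l) _; exact: measurable_fst.
  apply: measurable_vectorZ; first exact: measurable_snd.
  exact: measurable_vector_cst.
have h0 wz : (0 <= h wz)%E by rewrite lee_fin.
have -> : (\int[P]_w (Phi j i (partial_step W n k.+1 w))%:E =
    \int[P]_w h (Xid w, Z w))%E.
  by apply: eq_integral => w _; rewrite partial_stepS.
rewrite (@integral_independent_pair _ _ _ _ _ _ _ P nu Xid Z _ h mh h0); last first.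
  by move=> A B mA mB; exact: indep.
apply: ge0_le_integral => //.
- by move=> w _; exact: integral_ge0.
- exact: (measurableT_comp (measurable_fun_fubini_tonelli_F (m2 := nu) h mh h0) mid).
- apply/measurable_EFinP; apply: Phi_measurable => l.
  by apply: measurableT_comp (mY l) mid.
- by move=> w _; exact: (@Phi_noise j i (partial_step W n k w) k iK).
Qed.

Variable N : nat.
Hypothesis Phi_drift : forall j x, (j < N)%N ->
  Phi j K (tamed_drift f alpha dt x) <= Phi j.+1 0%N x.

Lemma expectation_step j n : (j < N)%N ->
  (\int[P]_w (Phi j 0%N (tamed_euler f sigma alpha W dt x0 n.+1 w))%:E <=
   \int[P]_w (Phi j.+1 0%N (tamed_euler f sigma alpha W dt x0 n w))%:E)%E.
Proof.
move=> jN.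
have mX l : measurable_vector (tamed_euler f sigma alpha W dt x0 l).
  by apply: measurable_tamed_euler => *; exact: measurable_increment.
(* The increments are integrated out from the last to the first: after i of them, K - i are left in
   the state and the potential has index i. *)
have noises i : (i <= K)%N ->
    (\int[P]_w (Phi j 0%N (partial_step W n K w))%:E <=
     \int[P]_w (Phi j i (partial_step W n (K - i) w))%:E)%E.
  elim: i => [_|i IH iK]; first by rewrite subn0.
  apply: le_trans (IH (ltnW iK)) _.
  have lt : (K - i.+1 < K)%N by rewrite ltn_subrL (leq_ltn_trans _ iK).
  have := @expectation_noise_step j n (Ordinal lt) i iK.
  by rewrite /= subnSK.
under eq_integral do rewrite -partial_stepK.
apply: le_trans (noises K (leqnn K)) _; rewrite subnn.
apply: ge0_le_integral => //.
- by move=> w _; rewrite lee_fin.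
- apply/measurable_EFinP; apply: Phi_measurable.
  by apply: measurable_partial_step => *; exact: measurable_increment.
- by apply/measurable_EFinP; apply: Phi_measurable.
- by move=> w _; rewrite lee_fin partial_step0 Phi_drift.
Qed.

Lemma expectation_tamed_euler n : (n <= N)%N ->
  (\int[P]_w (Phi 0%N 0%N (tamed_euler f sigma alpha W dt x0 n w))%:E <=
   (Phi n 0%N x0)%:E)%E.
Proof.
(* The number j of remaining steps is generalised: each [expectation_step] lowers the time index by
   one and raises j by one. *)
suff h j : (j + n <= N)%N ->
  (\int[P]_w (Phi j 0%N (tamed_euler f sigma alpha W dt x0 n w))%:E <=
   (Phi (j + n)%N 0%N x0)%:E)%E by exact: (h 0%N).
elim: n j => [|n IH] j jnN.
  rewrite addn0 /= integral_cst //=.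
  by rewrite [X in (_ * X)%E](probability_setT P) mule1.
apply: le_trans (@expectation_step j n _) _.
  by rewrite (leq_trans _ jnN) // addnS ltnS leq_addr.
by rewrite addnS -addSn; apply: IH; rewrite addSn -addnS.
Qed.

End scheme.

Theorem theorem3p1 (R : realType) (d K : nat)
    (f : 'rV[R]_d -> 'rV[R]_d) (sigma : 'I_K -> 'rV[R]_d) (alpha dt0 : R)
    (alpha_gt0 : 0 < alpha) (dt0_gt0 : 0 < dt0)
    (f_C2 : classC 2 f)
    (f_growth : exists q : nat, poly_growth f 2 q)
    (f_one_sided : exists gamma : R, 0 < gamma /\ one_sided_lipschitz f gamma)
    (m : R) (m_ge1 : 1 <= m) :
  exists Pm : {poly {poly R}},
    forall (disp : measure_display) (Omega : measurableType disp)
      (P : probability Omega R) (F : R -> set (set Omega))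
      (beta : 'I_K -> R -> {RV P >-> R}),
      usual_conditions P F ->
      (forall k, wiener_process P (beta k)) ->
      independent_processes P beta ->
      forall (T : R) (x0 : 'rV[R]_d), 0 < T ->
        (ereal_sup
          [set ereal_sup
            [set 'E_P[fun w =>
                (enorm (tamed_euler f sigma alpha beta dt x0 n w) `^ m)%R]
            | n in [set n : nat | (0 <= n%:R * dt <= T)%R]]
          | dt in [set dt : R | (0 < dt <= dt0)%R]]
         <= (Pm.[T%:P].[enorm x0])%:E)%E.
Proof.
have [q fq] := f_growth; have [gamma [gamma0 fg]] := f_one_sided.
have fc : continuous f by move=> x; apply: differentiable_continuous; case: f_C2.
have [Cf Cf0 fC] := poly_growth_sqr fq.
(* The crude bound has the integer degree l + 1 >= m; since 1 + |x| >= 1, it dominates the m-th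
   power. *)
pose l := Num.truncn m.
have ml : m <= l.+1%:R by apply: ltW; exact: truncnS_gt.
have pE : (q.+1 * l.+1).-1.+1 = (q.+1 * l.+1)%N by [].
have [C1 C10 [C2 C20 pot]] := @scheme_potential R d K f sigma alpha dt0 gamma Cf
  q l _ alpha_gt0 dt0_gt0 gamma0 fg Cf0 fC pE.
set p := _.-1 in pE pot.
(* The outer variable is [T] and the inner one |x0|: this is the bound a (V(x0) + C2 T) of
   [scheme_potential]. *)
exists ((2 + C1%:P%:P * 'X) ^+ l.+1 *
  (((1 + 'X ^+ 2) ^+ p.+1)%:P + C2%:P%:P * 'X)).
move=> disp Omega P F beta _ beta_wiener beta_indep T x0 T0.
apply: ge_ereal_sup => _ [dt /= dtP <-]; apply: ge_ereal_sup => _ [n /= nP <-].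
have [dt_gt0 _] := andP dtP; have [_ nT] := andP nP.
have [A [B [D [coef noiseP driftP startP endP]]]] := pot dt dtP T T0.
have PhiN := @expectation_tamed_euler R d K f sigma alpha dt x0 alpha_gt0 dt_gt0
  fc disp Omega P beta beta_wiener beta_indep
  (fun j i => potential l p (A j i) (B j i) (D j i)).
set X := tamed_euler f sigma alpha beta dt x0 n.
have mX : measurable_vector X.
  by apply: measurable_tamed_euler => // *; exact: measurable_increment.
rewrite unlock.
apply: (@le_trans _ _ (\int[P]_w
    (potential l p (A 0%N 0%N) (B 0%N 0%N) (D 0%N 0%N) (X w))%:E)%E).
  apply: ge0_le_integral => //.
  - by move=> w _; rewrite lee_fin powR_ge0.
  - apply/measurable_EFinP; apply: (measurableT_comp (@measurable_powR R m)).
    exact: measurable_enorm.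
  - by apply/measurable_EFinP; exact: measurable_potential.
  - move=> w _; rewrite lee_fin startP -powR_mulrn ?addr_ge0 ?enorm_ge0 //.
    apply: (@le_trans _ _ ((1 + enorm (X w)) `^ m)).
      apply: ge0_ler_powR; rewrite ?nnegrE ?addr_ge0 ?enorm_ge0 ?lerDr //.
      exact: le_trans m_ge1.
    by rewrite ler_powR // lerDl enorm_ge0.
apply: le_trans (PhiN _ _ _ n _ n (leqnn n)) _.
- move=> j i x; have [A1 B0 D0] := coef j i.
  by rewrite potential_ge0 // (le_trans _ A1).
- by move=> disp' T' g j i mg; exact: measurable_potential.
- exact: noiseP.
- move=> j x jn; apply: driftP; apply: le_trans nT.
  by rewrite ler_wpM2r ?ler_nat // ltW.
rewrite lee_fin; apply: le_trans (endP n x0 nT) _.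
by rewrite !hornerE /lyapunov -enorm_sqr.
Qed.
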